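(* Let $\mathcal{H}_A,\mathcal{H}_B$ be finite-dimensional Hilbert spaces and let $\mathcal{S}^{AB}=\{p_i,|\psi_i\rangle\}_{i=1}^n$ be a finite ensemble of pure states $|\psi_i\rangle\in\mathcal{H}_A\otimes\mathcal{H}_B$ with probabilities $p_i>0$, $\sum_i p_i=1$. Let $\rho^{AB}=\sum_i p_i|\psi_i\rangle\langle\psi_i|$, $\rho^A=\mathrm{Tr}_B\,\rho^{AB}$, $\rho^B=\mathrm{Tr}_A\,\rho^{AB}$, and assume $S(\rho^{AB})>0$. Then for every proper measure of entanglement $E$, $$\mathcal{R}_E\left(\mathcal{S}^{AB}\right)\le 1-\frac{\left|S\left(\rho^{A}\right)-S\left(\rho^{B}\right)\right|}{S\left(\rho^{AB}\right)}.$$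
   Context: $S(\cdot)$ denotes the von Neumann entropy and $H(\{p_i\})=-\sum_i p_i\log p_i$ the Shannon entropy. A proper measure of entanglement is a function $E$ on bipartite states (for all finite dimensions) which is an entanglement monotone (non-increasing under LOCC), equals the entropy of entanglement on pure states (i.e. $E(|\psi\rangle)=S(\mathrm{Tr}_B|\psi\rangle\langle\psi|)$), and is asymptotically continuous. For an ensemble $\mathcal{S}^{AB}=\{p_i,\sigma_i\}$ of bipartite states (viewed as an i.i.d. source: $N$ uses produce $\sigma_{i_1}\otimes\cdots\otimes\sigma_{i_N}$ with probability $p_{i_1}\cdots p_{i_N}$), define $$E\left(\mathcal{S}^{AB}\right)=\lim_{N\to\infty}\frac1N\sum_{i_1,\dots,i_N}p_{i_1}\cdots p_{i_N}\,E\left(\sigma_{i_1}\otimes\cdots\otimes\sigma_{i_N}\right),$$ where the bipartite cut places all $A$ subsystems on one side and all $B$ subsystems on the other. For a bipartite state $\rho$, $E^{\infty}(\rho)=\lim_{N\to\infty}\frac1N E(\rho^{\otimes N})$. The unlocking rate of the source is $$\mathcal{R}_E\left(\mathcal{S}^{AB}\right)=\frac{E\left(\mathcal{S}^{AB}\right)-E^{\infty}(\rho)}{H(\{p_i\})},\qquad \rho=\sum_i p_i\sigma_i.$$ (Note $H(\{p_i\})\ge S(\rho^{AB})>0$ under the hypotheses.) *)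

(* Defs.v *)
From HB Require Import structures.
From mathcomp Require Import all_boot all_order all_algebra.
From mathcomp Require Import all_classical all_reals all_analysis.
From mathcomp Require Import complex.
Set Implicit Arguments. Unset Strict Implicit. Unset Printing Implicit Defensive.
Import Order.TTheory GRing.Theory Num.Theory.
Import numFieldNormedType.Exports.
Local Open Scope classical_set_scope.
Local Open Scope ring_scope.

Definition adjmx (R : realType) m n (A : 'M[R[i]]_(m, n)) : 'M[R[i]]_(n, m) :=
  (map_mx (@conjc R) A)^T.

Definition mentry (T : nmodType) m n (A : 'M[T]_(m, n)) (i j : nat) : T :=
  match @insub _ (fun k => k < m)%N _ i, @insub _ (fun k => k < n)%N _ j with
  | Some i', Some j' => A i' j'
  | _, _ => 0
  end.

(* Kronecker product; composite index of (x1, x2) is x1 * m2 + x2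
   (first factor = A-system, most significant). *)
Definition kron (R : realType) m1 n1 m2 n2
  (A : 'M[R[i]]_(m1, n1)) (B : 'M[R[i]]_(m2, n2)) : 'M[R[i]]_(m1 * m2, n1 * n2) :=
  \matrix_(x, y) (mentry A (x %/ m2) (y %/ n2) * mentry B (x %% m2) (y %% n2)).

Definition hermitian (R : realType) n (A : 'M[R[i]]_n) : Prop := adjmx A = A.

Definition psd (R : realType) n (A : 'M[R[i]]_n) : Prop :=
  hermitian A /\ forall v : 'cV[R[i]]_n, 0 <= (adjmx v *m A *m v) 0 0.

Definition is_state (R : realType) n (rho : 'M[R[i]]_n) : Prop :=
  psd rho /\ \tr rho = 1.

Definition unit_vector (R : realType) n (psi : 'cV[R[i]]_n) : Prop :=
  (adjmx psi *m psi) 0 0 = 1.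

Definition ketbra (R : realType) n (psi : 'cV[R[i]]_n) : 'M[R[i]]_n :=
  psi *m adjmx psi.

Definition ptrB (R : realType) dA dB (rho : 'M[R[i]]_(dA * dB)) : 'M[R[i]]_dA :=
  \matrix_(a, a') \sum_(b < dB) mentry rho (a * dB + b) (a' * dB + b).
Definition ptrA (R : realType) dA dB (rho : 'M[R[i]]_(dA * dB)) : 'M[R[i]]_dB :=
  \matrix_(b, b') \sum_(a < dA) mentry rho (a * dB + b) (a * dB + b').

Arguments ptrB {R} dA dB rho.
Arguments ptrA {R} dA dB rho.

Definition eigdec (R : realType) n (A : 'M[R[i]]_n) (d : 'I_n -> R) : Prop :=
  exists U : 'M[R[i]]_n, U *m adjmx U = 1%:M /\
    A = U *m diag_mx (\row_k ((d k)%:C)%C) *m adjmx U.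

(* eigenvalues of a Hermitian matrix (chosen; 0 if A is not Hermitian) *)
Definition spec (R : realType) n (A : 'M[R[i]]_n) : 'I_n -> R :=
  match pselect (exists d, eigdec A d) with
  | left P => proj1_sig (cid P)
  | right _ => fun _ => 0
  end.

Definition vnS (R : realType) n (A : 'M[R[i]]_n) : R :=
  \sum_(k < n) - (spec A k * ln (spec A k)).

Definition trnorm (R : realType) n (A : 'M[R[i]]_n) : R :=
  \sum_(k < n) `|spec A k|.

Definition shannon (R : realType) n (p : 'I_n -> R) : R :=
  - \sum_(i < n) p i * ln (p i).

Definition digit (d k a : nat) : nat := (a %/ d ^ k) %% d.

(* sigma_0 (x) ... (x) sigma_{N-1}, with all A factors on one side and all B
   factors on the other: index of the composite system is a * dB^N + b,
   a = sum_k a_k dA^k, b = sum_k b_k dB^k. *)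
Definition prodstate (R : realType) dA dB N (sigma : 'I_N -> 'M[R[i]]_(dA * dB)) :
  'M[R[i]]_(dA ^ N * dB ^ N) :=
  \matrix_(x, y) \prod_(k < N)
     mentry (sigma k)
       (digit dA k (x %/ dB ^ N) * dB + digit dB k (x %% dB ^ N))
       (digit dA k (y %/ dB ^ N) * dB + digit dB k (y %% dB ^ N)).

Definition actA (R : realType) dA dA1 dB (K : 'M[R[i]]_(dA1, dA))
  (rho : 'M[R[i]]_(dA * dB)) : 'M[R[i]]_(dA1 * dB) :=
  kron K (1%:M : 'M[R[i]]_dB) *m rho *m adjmx (kron K (1%:M : 'M[R[i]]_dB)).
Definition actB (R : realType) dA dB dB1 (K : 'M[R[i]]_(dB1, dB))
  (rho : 'M[R[i]]_(dA * dB)) : 'M[R[i]]_(dA * dB1) :=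
  kron (1%:M : 'M[R[i]]_dA) K *m rho *m adjmx (kron (1%:M : 'M[R[i]]_dA) K).

(* A map is LOCC if it is the identity, or if one party performs a local
   instrument with Kraus operators K_j (sum_j K_j^dagger K_j = 1), broadcasts
   the outcome j, and the parties continue with an LOCC map depending on j. *)
Inductive LOCC (R : realType) :
  forall dA dB dA' dB' : nat, ('M[R[i]]_(dA * dB) -> 'M[R[i]]_(dA' * dB')) -> Prop :=
| LOCC_id dA dB (Phi : 'M[R[i]]_(dA * dB) -> 'M[R[i]]_(dA * dB)) :
    (forall rho, Phi rho = rho) -> LOCC Phi
| LOCC_A dA dB dA1 dA' dB' (m : nat) (K : 'I_m -> 'M[R[i]]_(dA1, dA))
    (Phis : 'I_m -> 'M[R[i]]_(dA1 * dB) -> 'M[R[i]]_(dA' * dB'))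
    (Phi : 'M[R[i]]_(dA * dB) -> 'M[R[i]]_(dA' * dB')) :
    \sum_(j < m) adjmx (K j) *m K j = 1%:M ->
    (forall j, LOCC (Phis j)) ->
    (forall rho, Phi rho = \sum_(j < m) Phis j (actA (K j) rho)) ->
    LOCC Phi
| LOCC_B dA dB dB1 dA' dB' (m : nat) (K : 'I_m -> 'M[R[i]]_(dB1, dB))
    (Phis : 'I_m -> 'M[R[i]]_(dA * dB1) -> 'M[R[i]]_(dA' * dB'))
    (Phi : 'M[R[i]]_(dA * dB) -> 'M[R[i]]_(dA' * dB')) :
    \sum_(j < m) adjmx (K j) *m K j = 1%:M ->
    (forall j, LOCC (Phis j)) ->
    (forall rho, Phi rho = \sum_(j < m) Phis j (actB (K j) rho)) ->
    LOCC Phi.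

Definition bip_fun (R : realType) := forall dA dB : nat, 'M[R[i]]_(dA * dB) -> R.

Definition entanglement_monotone (R : realType) (E : bip_fun R) : Prop :=
  forall dA dB dA' dB' (Phi : 'M[R[i]]_(dA * dB) -> 'M[R[i]]_(dA' * dB'))
    (rho : 'M[R[i]]_(dA * dB)),
    LOCC Phi -> is_state rho -> E dA' dB' (Phi rho) <= E dA dB rho.

Definition normalized_on_pure (R : realType) (E : bip_fun R) : Prop :=
  forall dA dB (psi : 'cV[R[i]]_(dA * dB)), unit_vector psi ->
    E dA dB (ketbra psi) = vnS (ptrB dA dB (ketbra psi)).

Definition asymptotically_continuous (R : realType) (E : bip_fun R) : Prop :=
  forall (dA dB : nat -> nat) (rho sigma : forall k, 'M[R[i]]_(dA k * dB k)),
    (forall k, is_state (rho k)) -> (forall k, is_state (sigma k)) ->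
    (fun k => trnorm (rho k - sigma k)) @ \oo --> (0 : R) ->
    (fun k => (E _ _ (rho k) - E _ _ (sigma k)) / (1 + ln ((dA k * dB k)%:R)))
      @ \oo --> (0 : R).

Definition proper_measure (R : realType) (E : bip_fun R) : Prop :=
  [/\ entanglement_monotone E, normalized_on_pure E & asymptotically_continuous E].

Definition ens_seq (R : realType) (E : bip_fun R) dA dB n (p : 'I_n -> R)
  (sigma : 'I_n -> 'M[R[i]]_(dA * dB)) (N : nat) : R :=
  N%:R^-1 * \sum_(t : {ffun 'I_N -> 'I_n})
     (\prod_(k < N) p (t k)) * E _ _ (prodstate (fun k => sigma (t k))).

Definition reg_seq (R : realType) (E : bip_fun R) dA dB
  (rho : 'M[R[i]]_(dA * dB)) (N : nat) : R :=
  N%:R^-1 * E _ _ (prodstate (fun _ : 'I_N => rho)).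

(* Main.v *)
(** On pure states [E] is the entropy of entanglement, so [ES] is the average entropy of
    the reduced states of the [psi i]; by concavity and the Schmidt decomposition it is at most
    [min (S rho^A) (S rho^B)]. The other half is the hashing bound
    [Einf >= max (S rho^A) (S rho^B) - S rho], proved by an explicit one-way LOCC protocol. One
    party measures with all (normalised) sign matrices of height [L]. The fourth moments of
    random signs show that, as long as [L] is below [exp (N (S rho^B - S rho))], the outcome is
    on average almost decoupled from the purifying system, and then the other party recovers a
    maximally entangled state of rank [L] by the contraction [2 U (1 + U^dagger U)^-1] built
    from the operators [U] that link the typical eigenvectors of [rho] to his typical subspace.
    Monotonicity and asymptotic continuity turn this into the bound on [Einf]. Hence
    [ES - Einf <= S rho - `|S rho^A - S rho^B|], which is nonnegative by the Araki-Lieb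
    inequality, and dividing by [H p >= S rho] gives the claim. *)
Require Import Defs.
From HB Require Import structures.
From mathcomp Require Import all_boot all_order all_algebra ring lra.
From mathcomp Require Import all_classical all_reals all_analysis.
From mathcomp Require Import complex.
Set Implicit Arguments. Unset Strict Implicit. Unset Printing Implicit Defensive.
Import Order.TTheory GRing.Theory Num.Theory.
Import numFieldNormedType.Exports.
Local Open Scope classical_set_scope.
Local Open Scope ring_scope.

(** * Random sign matrices and the one-shot decoder *)

(** Decoupling is usually turned into a decoder by Uhlmann's theorem and a polar decomposition. Here
    the decoder stays rational: with [Q] the sum of the [adj (U k) *m U k], only the inverse of
    [1 + Q] occurs, and the scalar inequality [4 / (1 + q) >= 3 - q], with contact at the ideal
    value [q = 1], bounds its quality by expressions of degree at most four in the signs. Fidelity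
    is quadratic in the overlap; [y ^+ 2 >= 2 * y - 1] makes it linear before the average is taken.
    Sign matrices form a finite family, so they are exactly complete as a measurement and every
    average is a finite sum. Typicality is needed on one side only for each spectrum: eigenvalues of
    [rho] that are not too small, eigenvalues of the decoding party's marginal that are not too
    large. Their ratio limits [L]. The output lives on [L * L] dimensions with [ln L] of order [N],
    so the denominator in asymptotic continuity is of the same order as the entanglement that is
    compared. Bipartite vectors are treated as matrices throughout: one party multiplies on the
    left, the other on the right by a transpose. *)

Section Adjoint.
Variable C : numClosedFieldType.

Definition adj m n (A : 'M[C]_(m, n)) : 'M[C]_(n, m) := (map_mx Num.conj A)^T.

Lemma adjE m n (A : 'M[C]_(m, n)) i j : adj A i j = (A j i)^*.
Proof. by rewrite !mxE. Qed.

Lemma adjK m n (A : 'M[C]_(m, n)) : adj (adj A) = A.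
Proof. by apply/matrixP => i j; rewrite !adjE conjCK. Qed.

Lemma adjM m n p (A : 'M[C]_(m, n)) (B : 'M[C]_(n, p)) :
  adj (A *m B) = adj B *m adj A.
Proof. by rewrite /adj map_mxM trmx_mul. Qed.

Lemma adjD m n (A B : 'M[C]_(m, n)) : adj (A + B) = adj A + adj B.
Proof. by rewrite /adj map_mxD linearD. Qed.

Lemma adjB m n (A B : 'M[C]_(m, n)) : adj (A - B) = adj A - adj B.
Proof. by rewrite /adj map_mxB linearB. Qed.

Lemma adj0 m n : adj (0 : 'M[C]_(m, n)) = 0.
Proof. by rewrite /adj map_mx0 trmx0. Qed.

Lemma adj1 n : adj (1%:M : 'M[C]_n) = 1%:M.
Proof. by rewrite /adj map_mx1 trmx1. Qed.

Lemma adjZ m n (a : C) (A : 'M[C]_(m, n)) : adj (a *: A) = a^* *: adj A.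
Proof. by rewrite /adj map_mxZ linearZ. Qed.

Lemma adj_sum (I : Type) (r : seq I) (P : pred I) m n (A : I -> 'M[C]_(m, n)) :
  adj (\sum_(i <- r | P i) A i) = \sum_(i <- r | P i) adj (A i).
Proof.
by elim/big_rec2: _ => [|i x y _ <-]; rewrite ?adj0 ?adjD.
Qed.

Lemma trace_adj n (A : 'M[C]_n) : \tr (adj A) = (\tr A)^*.
Proof. by rewrite /adj mxtrace_tr raddf_sum; apply: eq_bigr => i _; rewrite mxE. Qed.

Lemma adj_diag_real n (d : 'rV[C]_n) : (forall k, d 0 k \is Num.real) ->
  adj (diag_mx d) = diag_mx d.
Proof.
move=> hd; apply/matrixP => i j; rewrite adjE !mxE.
case: eqVneq => [->|]; first by rewrite ?eqxx mulr1n (CrealP (hd _)).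
by rewrite mulr0n conjC0.
Qed.

Lemma adj_scalar_real n (a : C) : a \is Num.real -> adj (a%:M : 'M[C]_n) = a%:M.
Proof. by move=> /CrealP ar; rewrite -scalemx1 adjZ adj1 ar. Qed.

Lemma adj_conj m n (A : 'M[C]_(m, n)) :
  adj (map_mx Num.conj A) = map_mx Num.conj (adj A).
Proof. by rewrite /adj map_trmx. Qed.

Lemma gram_tr m n p (A : 'M[C]_(m, n)) (B : 'M[C]_(m, p)) :
  A^T *m adj B^T = (adj B *m A)^T.
Proof. by rewrite trmx_mul /adj trmxK map_trmx trmxK. Qed.

Lemma conj_unitary n (W : 'M[C]_n) : W *m adj W = 1%:M ->
  map_mx Num.conj W *m adj (map_mx Num.conj W) = 1%:M.
Proof. by move=> hW; rewrite adj_conj -map_mxM hW map_mx1. Qed.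

Definition hsnorm2 m n (A : 'M[C]_(m, n)) : C := \tr (A *m adj A).

Lemma hsnorm2E m n (A : 'M[C]_(m, n)) :
  hsnorm2 A = \sum_i \sum_j `|A i j| ^+ 2.
Proof.
by apply: eq_bigr => i _; rewrite mxE; apply: eq_bigr => j _; rewrite adjE normCK.
Qed.

Lemma hsnorm2_ge0 m n (A : 'M[C]_(m, n)) : 0 <= hsnorm2 A.
Proof.
rewrite hsnorm2E; apply: sumr_ge0 => i _; apply: sumr_ge0 => j _.
by rewrite exprn_ge0.
Qed.

Lemma hsnorm2_eq0 m n (A : 'M[C]_(m, n)) : hsnorm2 A = 0 -> A = 0.
Proof.
rewrite hsnorm2E => h; apply/matrixP => i j; rewrite mxE.
have hi k : 0 <= \sum_j `|A k j| ^+ 2 by apply: sumr_ge0 => l _; rewrite exprn_ge0.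
have {}h k : \sum_j `|A k j| ^+ 2 = 0 by exact: (psumr_eq0P (fun l _ => hi l) h).
have /eqP : `|A i j| ^+ 2 = 0.
  by apply: (psumr_eq0P _ (h i)) => // l _; rewrite exprn_ge0.
by rewrite expf_eq0 normr_eq0 => /eqP.
Qed.

End Adjoint.

(** * Contractions built from a Gram matrix and their Cayley completion *)

Section InverseIdentities.
Variables (C : comRingType) (n : nat) (A G : 'M[C]_n).
Hypotheses (AG : A *m G = 1%:M) (GA : G *m A = 1%:M).

Lemma sandwich_two_sub :
  (2%:M - A) *m G *m (2%:M - A) = 4 *: G - 3 *: 1%:M + (A - 1%:M).
Proof.
rewrite !mulmxBl AG mulmxBr mul1mx mul_scalar_mx mul_mx_scalar -scalemxAl GA.
apply/matrixP => i j; rewrite !mxE; ring.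
Qed.

(** For a scalar [A = 1 + q] this is [4 q / (1 + q)^2 + ((1 - q) / (1 + q))^2 = 1], the half-angle
    identity behind the Cayley transform. *)
Lemma sandwich_inverse :
  4 *: (G *m (A - 1%:M) *m G) + (2 *: G - 1%:M) *m (2 *: G - 1%:M) = 1%:M.
Proof.
rewrite !mulmxBl !mulmxBr GA !mulmxBl !mulmx1 !mul1mx -!scalemxAl -!scalemxAr.
apply/matrixP => i j; rewrite !mxE; ring.
Qed.

End InverseIdentities.

Section Cayley.
Variables (C : numClosedFieldType) (I : finType) (L n : nat).
Variable U : I -> 'M[C]_(L, n).
Let Q := \sum_k adj (U k) *m U k.
Let A := 1%:M + Q.

Lemma trace_gram p (X : 'M[C]_(p, n)) :
  \tr (X *m Q *m adj X) = \sum_k hsnorm2 (X *m adj (U k)).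
Proof.
rewrite mulmx_sumr mulmx_suml raddf_sum; apply: eq_bigr => k _ /=.
by rewrite /hsnorm2 adjM adjK !mulmxA.
Qed.

Lemma adj_gram : adj Q = Q.
Proof. by rewrite adj_sum; apply: eq_bigr => k _; rewrite adjM adjK. Qed.

Lemma trace_gram1_ge p (X : 'M[C]_(p, n)) : hsnorm2 X <= \tr (X *m A *m adj X).
Proof.
rewrite mulmxDr mulmx1 mulmxDl raddfD /= trace_gram lerDl sumr_ge0 // => k _.
exact: hsnorm2_ge0.
Qed.

(** [Q] is positive, so [A] dominates the identity and the Hilbert-Schmidt norm of its kernel matrix
    is at most zero. *)
Lemma gram1_unit : A \in unitmx.
Proof.
rewrite -row_free_unit -kermx_eq0; apply/eqP/hsnorm2_eq0/le_anti.
rewrite hsnorm2_ge0 andbT; apply: le_trans (trace_gram1_ge _) _.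
by rewrite mulmx_ker mul0mx mxtrace0.
Qed.

Let G := invmx A.
Let AG : A *m G = 1%:M. Proof. exact: mulmxV gram1_unit. Qed.
Let GA : G *m A = 1%:M. Proof. exact: mulVmx gram1_unit. Qed.
Let QE : Q = A - 1%:M. Proof. by rewrite /A addrC addKr. Qed.

Lemma adj_gram1 : adj A = A.
Proof. by rewrite adjD adj1 adj_gram. Qed.

Lemma adj_gram_inv : adj G = G.
Proof.
by rewrite -[RHS]mul1mx -adj1 -AG adjM adj_gram1 -mulmxA AG mulmx1.
Qed.

Lemma trace_gram_inv_ge0 p (X : 'M[C]_(p, n)) : 0 <= \tr (X *m G *m adj X).
Proof.
have -> : X *m G *m adj X = (X *m G) *m A *m adj (X *m G).
  by rewrite adjM adj_gram_inv !mulmxA -(mulmxA X G A) GA mulmx1.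
exact: le_trans (hsnorm2_ge0 _) (trace_gram1_ge _).
Qed.

(** Completeness of an instrument with success branches [2 U G] and one failure branch. At [Q = 1],
    where the [U k] already form an instrument, [G] is one half, the success branches are the [U k]
    and the failure branch is zero. *)
Lemma cayley_complete :
  \sum_k adj (2 *: (U k *m G)) *m (2 *: (U k *m G))
  + adj ((1%:M - Q) *m G) *m ((1%:M - Q) *m G) = 1%:M.
Proof.
have -> : \sum_k adj (2 *: (U k *m G)) *m (2 *: (U k *m G)) = 4 *: (G *m Q *m G).
  rewrite mulmx_sumr mulmx_suml scaler_sumr; apply: eq_bigr => k _.
  rewrite adjZ conjC_nat -scalemxAl -scalemxAr scalerA adjM adj_gram_inv !mulmxA.
  by rewrite -natrM.
have e : 1%:M - Q = 2%:M - A.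
  rewrite QE opprB addrA -raddfD /=; congr (_ - _).
have -> : (1%:M - Q) *m G = 2 *: G - 1%:M by rewrite e mulmxBl AG mul_scalar_mx.
by rewrite adjB adjZ conjC_nat adj1 adj_gram_inv QE sandwich_inverse.
Qed.

(* [4 G - 3 + Q = (1 - Q) G (1 - Q)] *)
Lemma trace_gram_inv_ge p (X : 'M[C]_(p, n)) :
  3 * hsnorm2 X - \tr (X *m Q *m adj X) <= 4 * \tr (X *m G *m adj X).
Proof.
have := trace_gram_inv_ge0 (X *m (2%:M - A)).
rewrite adjM adjB adj_gram1.
have -> : adj (2%:M : 'M[C]_n) = 2%:M by rewrite adj_scalar_real ?realn.
have -> : X *m (2%:M - A) *m G *m ((2%:M - A) *m adj X) =
    X *m ((2%:M - A) *m G *m (2%:M - A)) *m adj X by rewrite !mulmxA.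
rewrite sandwich_two_sub // -QE mulmxDr mulmxBr mulmxDl mulmxBl.
rewrite -!scalemxAr -!scalemxAl mulmx1 mxtraceD raddfB /= !mxtraceZ -/(hsnorm2 X).
set a := 4 * _; set b := 3 * _; set c := \tr _ => h.
by rewrite -subr_ge0 opprB addrA addrAC.
Qed.

End Cayley.

Lemma sum_delta (R : pzRingType) (I : finType) (F : I -> R) (i : I) :
  \sum_j F j * (i == j)%:R = F i.
Proof.
rewrite (bigD1 i) //= eqxx mulr1 big1 ?addr0 // => j.
by rewrite eq_sym => /negbTE ->; rewrite mulr0.
Qed.

(** * Second and fourth moments of random signs *)

Section SignMoments.
Variables (C : numClosedFieldType) (X : finType).
Implicit Types (s : {ffun X -> bool}) (x y z w : X).

Definition sgn s x : C := (-1) ^+ s x.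
Let card : C := #|{ffun X -> bool}|%:R.

Lemma sgnK s x : sgn s x * sgn s x = 1.
Proof. by rewrite /sgn -expr2 sqrr_sign. Qed.

Lemma conj_sgn s x : (sgn s x)^* = sgn s x.
Proof. by rewrite /sgn rmorphXn rmorphN rmorph1. Qed.

Definition flip x s : {ffun X -> bool} := [ffun y => if y == x then ~~ s y else s y].

Lemma flipK x : involutive (flip x).
Proof.
by move=> s; apply/ffunP => y; rewrite !ffunE; case: eqP => //; rewrite negbK.
Qed.

Lemma sgn_flip x s y : sgn (flip x s) y = if y == x then - sgn s y else sgn s y.
Proof.
by rewrite /sgn ffunE; case: eqP => // _; case: (s y); rewrite /= !(expr0, expr1) ?opprK.
Qed.

(** Flipping the sign at [x] is an involution that negates the summand, so the sum equals its own
    opposite. Any unpaired sign is averaged away in this manner. *)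
Lemma sum_sgn_odd x (F : {ffun X -> bool} -> C) :
  (forall s, F (flip x s) = F s) -> \sum_s sgn s x * F s = 0.
Proof.
move=> hF; set S := \sum_s _.
have : S = - S.
  rewrite {1}/S (reindex_inj (inv_inj (flipK x))) -sumrN.
  by apply: eq_bigr => s _; rewrite hF sgn_flip eqxx mulNr.
by move/eqP; rewrite -addr_eq0 -mulr2n mulrn_eq0 => /eqP.
Qed.

Lemma sum_sgn2 x y : \sum_s sgn s x * sgn s y = card * (x == y)%:R.
Proof.
case: (eqVneq x y) => [<-|nxy]; last first.
  rewrite mulr0; apply: (@sum_sgn_odd x (fun s => sgn s y)) => s.
  by rewrite sgn_flip eq_sym (negbTE nxy).
by under eq_bigr do rewrite sgnK; rewrite sumr_const mulr1.
Qed.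

(** The three terms are the pairings of four indices. When all four coincide they count three while
    the moment is one, hence the correction [- 2]. *)
Lemma sum_sgn4 x y z w :
  \sum_s sgn s x * sgn s y * (sgn s z * sgn s w) =
  card * ((x == y)%:R * (z == w)%:R + (x == z)%:R * (y == w)%:R
          + (x == w)%:R * (y == z)%:R
          - 2 * ((x == y)%:R * (x == z)%:R * (x == w)%:R)).
Proof.
case: (eqVneq x y) => [<-|nxy].
  under eq_bigr do rewrite sgnK mul1r.
  rewrite sum_sgn2; congr (_ * _).
  case: (eqVneq x z) => [exz|nxz]; case: (eqVneq x w) => [exw|nxw]; try subst z;
    try subst w; rewrite ?eqxx ?[z == x]eq_sym; try rewrite (negbTE nxz);
    try rewrite (negbTE nxw); rewrite /= ?mulr0n ?mulr1n; ring.
case: (eqVneq x z) => [exz|nxz]; first subst z.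
  under eq_bigr do rewrite mulrACA sgnK mul1r.
  rewrite sum_sgn2; congr (_ * _).
  case: (eqVneq x w) => [exw|nxw]; try subst w;
    rewrite ?[y == x]eq_sym ?(negbTE nxy) /= ?mulr0n ?mulr1n; ring.
case: (eqVneq x w) => [exw|nxw]; first subst w.
  under eq_bigr do rewrite [sgn _ z * _]mulrC mulrACA sgnK mul1r.
  by rewrite sum_sgn2; congr (_ * _); rewrite /= ?mulr0n ?mulr1n; ring.
under eq_bigr do rewrite -mulrA.
rewrite (@sum_sgn_odd x (fun s => sgn s y * (sgn s z * sgn s w))).
  by rewrite /= ?mulr0n ?mulr1n; ring.
by move=> s; rewrite !sgn_flip ![_ == x]eq_sym (negbTE nxy) (negbTE nxz) (negbTE nxw).
Qed.

End SignMoments.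

Section SignMatrices.
Variables (C : numClosedFieldType) (L m : nat).
Let S := {ffun 'I_L * 'I_m -> bool}.
Let card : C := #|{: S}|%:R.

Definition signmx (s : S) : 'M[C]_(L, m) := \matrix_(l, a) sgn C s (l, a).

Lemma sum_signmx_gram : \sum_(s : S) adj (signmx s) *m signmx s = (card * L%:R)%:M.
Proof.
apply/matrixP => a b; rewrite summxE !mxE.
under eq_bigr do rewrite mxE.
rewrite exchange_big /=.
transitivity (\sum_(l < L) card * (a == b)%:R).
  apply: eq_bigr => l _; rewrite -[a == b](_ : ((l, a) == (l, b)) = _) -?sum_sgn2.
    by apply: eq_bigr => s _; rewrite adjE !mxE conj_sgn.
  by rewrite xpair_eqE eqxx.
by rewrite sumr_const card_ord -[RHS]mulr_natr -[LHS]mulr_natr; ring.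
Qed.

Lemma sum_signmx_trace (B : 'M[C]_m) :
  \sum_(s : S) \tr (signmx s *m B *m adj (signmx s)) = card * L%:R * \tr B.
Proof.
under eq_bigr do rewrite -mulmxA mxtrace_mulC -mulmxA.
rewrite -raddf_sum -mulmx_sumr sum_signmx_gram mul_mx_scalar /=.
by rewrite mxtraceZ.
Qed.

Lemma signmx_sandwichE s (B : 'M[C]_m) l k :
  (signmx s *m B *m adj (signmx s)) l k =
  \sum_a \sum_b B a b * (sgn C s (l, a) * sgn C s (k, b)).
Proof.
rewrite mxE exchange_big /=; apply: eq_bigr => b _; rewrite !mxE big_distrl /=.
by apply: eq_bigr => a _; rewrite !mxE conj_sgn mulrAC mulrA mulrC mulrA.
Qed.

(** The left side is the crosswise pairing of the fourth moment. Twice the gap is the sum of the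
    [|B a b - B b a|^2], which is nonnegative. *)
Lemma sum_swap_le (B : 'M[C]_m) :
  \sum_a \sum_b B a b * (B b a)^* <= hsnorm2 B.
Proof.
rewrite hsnorm2E; set Z := (X in X <= _); set H := (X in _ <= X).
suff : 0 <= 2 * (H - Z) by rewrite pmulr_rge0 ?ltr0n // subr_ge0.
suff -> : 2 * (H - Z) = \sum_a \sum_b `|B a b - B b a| ^+ 2.
  by apply: sumr_ge0 => a _; apply: sumr_ge0 => b _; rewrite exprn_ge0.
have e : 2 * (H - Z) = (H + \sum_a \sum_b `|B b a| ^+ 2) - (Z + \sum_a \sum_b B b a * (B a b)^*).
  have -> : \sum_a \sum_b `|B b a| ^+ 2 = H by rewrite exchange_big.
  have -> : \sum_a \sum_b B b a * (B a b)^* = Z by rewrite exchange_big.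
  by ring.
rewrite e /H /Z -!big_split /= -sumrB; apply: eq_bigr => a _.
rewrite -!big_split /= -sumrB; apply: eq_bigr => b _.
by rewrite !normCK rmorphB /=; ring.
Qed.

Lemma sum_signmx_entry (B : 'M[C]_m) l k :
  \sum_(s : S) `|(signmx s *m B *m adj (signmx s)) l k| ^+ 2 =
  \sum_a \sum_b \sum_a' \sum_b' B a b * (B a' b')^* *
    \sum_(s : S) sgn C s (l, a) * sgn C s (k, b) * (sgn C s (l, a') * sgn C s (k, b')).
Proof.
transitivity (\sum_(s : S) \sum_a \sum_b \sum_a' \sum_b' B a b * (B a' b')^* *
    (sgn C s (l, a) * sgn C s (k, b) * (sgn C s (l, a') * sgn C s (k, b')))).
  apply: eq_bigr => s _; rewrite normCK signmx_sandwichE rmorph_sum big_distrl /=.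
  apply: eq_bigr => a _; rewrite big_distrl /=; apply: eq_bigr => b _.
  rewrite big_distrr /=; apply: eq_bigr => a' _.
  rewrite rmorph_sum big_distrr /=; apply: eq_bigr => b' _.
  by rewrite !rmorphM /= !conj_sgn; ring.
rewrite exchange_big /=; apply: eq_bigr => a _.
rewrite exchange_big /=; apply: eq_bigr => b _.
rewrite exchange_big /=; apply: eq_bigr => a' _.
rewrite exchange_big /=; apply: eq_bigr => b' _.
by rewrite big_distrr.
Qed.

(** Signs in different rows never pair up, so the only pairing left matches [B] entrywise with its
    conjugate. *)
Lemma sum_signmx_entry_offdiag (B : 'M[C]_m) l k : l != k ->
  \sum_(s : S) `|(signmx s *m B *m adj (signmx s)) l k| ^+ 2 = card * hsnorm2 B.
Proof.
move=> nlk; rewrite sum_signmx_entry hsnorm2E big_distrr /=.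
apply: eq_bigr => a _; rewrite big_distrr /=; apply: eq_bigr => b _.
transitivity (\sum_a' \sum_b' (card * (B a b * (B a' b')^* )) * (b == b')%:R * (a == a')%:R).
  apply: eq_bigr => a' _; apply: eq_bigr => b' _.
  rewrite sum_sgn4 !xpair_eqE !eqxx (negbTE nlk) /= !mulr0n -/card; ring.
under eq_bigr => a' _ do rewrite -big_distrl /= sum_delta.
by rewrite sum_delta normCK.
Qed.

Lemma sum_signmx_entry_diag (B : 'M[C]_m) l :
  \sum_(s : S) `|(signmx s *m B *m adj (signmx s)) l l| ^+ 2
  <= card * (`|\tr B| ^+ 2 + 2 * hsnorm2 B).
Proof.
have -> : \sum_(s : S) `|(signmx s *m B *m adj (signmx s)) l l| ^+ 2 =
  card * (`|\tr B| ^+ 2 + hsnorm2 B + \sum_a \sum_b B a b * (B b a)^*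
          - 2 * \sum_a `|B a a| ^+ 2).
  pose f1 a b a' b' := B a b * (B a' b')^* * (a' == b')%:R * (a == b)%:R.
  pose f2 a b a' b' := B a b * (B a' b')^* * (b == b')%:R * (a == a')%:R.
  pose f3 a b a' b' := B a b * (B a' b')^* * (a == b')%:R * (b == a')%:R.
  pose f4 a b a' b' :=
    B a b * (B a' b')^* * (a == b')%:R * (a == a')%:R * (a == b)%:R.
  pose S4 (f : 'I_m -> 'I_m -> 'I_m -> 'I_m -> C) :=
    \sum_a \sum_b \sum_a' \sum_b' f a b a' b'.
  have e1 : S4 f1 = `|\tr B| ^+ 2.
    rewrite normCK /mxtrace big_distrl /=; apply: eq_bigr => a _.
    have -> : (\sum_i B i i)^* = \sum_i (B i i)^* by rewrite rmorph_sum.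
    transitivity (\sum_b (\sum_a' B a b * (B a' a')^*) * (a == b)%:R).
      apply: eq_bigr => b _; rewrite big_distrl /=; apply: eq_bigr => a' _.
      by rewrite -big_distrl /= sum_delta.
    by rewrite sum_delta big_distrr.
  have e2 : S4 f2 = hsnorm2 B.
    rewrite hsnorm2E; apply: eq_bigr => a _; apply: eq_bigr => b _.
    under eq_bigr => a' _ do rewrite -big_distrl /= sum_delta.
    by rewrite sum_delta normCK.
  have e3 : S4 f3 = \sum_a \sum_b B a b * (B b a)^*.
    apply: eq_bigr => a _; apply: eq_bigr => b _.
    under eq_bigr => a' _ do rewrite -big_distrl /= sum_delta.
    by rewrite sum_delta.
  have e4 : S4 f4 = \sum_a `|B a a| ^+ 2.
    apply: eq_bigr => a _.
    under eq_bigr => b _.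
      under eq_bigr => a' _ do rewrite -!big_distrl /= sum_delta.
      rewrite -big_distrl /= sum_delta; over.
    by rewrite sum_delta normCK.
  rewrite -e1 -e2 -e3 -e4 sum_signmx_entry [2 * _]big_distrr /S4 -!big_split /= -sumrB.
  rewrite big_distrr /=; apply: eq_bigr => a _.
  rewrite [2 * _]big_distrr -!big_split /= -sumrB big_distrr /=; apply: eq_bigr => b _.
  rewrite [2 * _]big_distrr -!big_split /= -sumrB big_distrr /=; apply: eq_bigr => a' _.
  rewrite [2 * _]big_distrr -!big_split /= -sumrB big_distrr /=; apply: eq_bigr => b' _.
  by rewrite sum_sgn4 !xpair_eqE !eqxx /= -/card /f1 /f2 /f3 /f4; ring.
rewrite ler_wpM2l ?ler0n // [2 * hsnorm2 B]mulr_natl (mulr2n (hsnorm2 B)) addrA.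
rewrite -[leLHS]addrA lerD2l.
apply: (le_trans _ (sum_swap_le B)); rewrite gerBl; apply: mulr_ge0; first exact: ler0n.
by apply: sumr_ge0 => a _; rewrite exprn_ge0.
Qed.

(** The trace term appears only in the [L] diagonal entries, while the norm term appears in all
    [L ^+ 2]. Hence the norm term is the one that forces [L] to be small. *)
Lemma sum_signmx_hsnorm2 (B : 'M[C]_m) :
  \sum_(s : S) hsnorm2 (signmx s *m B *m adj (signmx s))
  <= card * (L%:R * `|\tr B| ^+ 2 + 2 * L%:R ^+ 2 * hsnorm2 B).
Proof.
under eq_bigr do rewrite hsnorm2E.
rewrite exchange_big /=; under eq_bigr do rewrite exchange_big /=.
have h l k : \sum_(s : S) `|(signmx s *m B *m adj (signmx s)) l k| ^+ 2 <=
  card * ((l == k)%:R * `|\tr B| ^+ 2 + 2 * hsnorm2 B).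
  case: (eqVneq l k) => [<-|nlk]; first by rewrite mul1r; exact: sum_signmx_entry_diag.
  rewrite sum_signmx_entry_offdiag // mul0r add0r ler_wpM2l ?ler0n //.
  by rewrite ler_peMl ?hsnorm2_ge0 ?ler1n.
apply: le_trans (ler_sum _ (fun l _ => ler_sum _ (fun k _ => h l k))) _.
rewrite le_eqVlt; apply/orP; left; apply/eqP.
have -> : L%:R * `|\tr B| ^+ 2 + 2 * L%:R ^+ 2 * hsnorm2 B =
   \sum_(l < L) (`|\tr B| ^+ 2 + L%:R * (2 * hsnorm2 B)).
  by rewrite sumr_const card_ord -mulr_natl; ring.
rewrite [RHS]big_distrr /=; apply: eq_bigr => l _; rewrite -big_distrr /=; congr (_ * _).
rewrite big_split /= sumr_const card_ord -[_ *+ L]mulr_natl; congr (_ + _).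
by under eq_bigr do rewrite mulrC; rewrite sum_delta.
Qed.

End SignMatrices.

Lemma mxtraceB (R : pzRingType) n (A B : 'M[R]_n) : \tr (A - B) = \tr A - \tr B.
Proof. exact: raddfB. Qed.

Lemma sqr_ge_tangent (C : numClosedFieldType) (y : C) :
  y \is Num.real -> 2 * y - 1 <= y ^+ 2.
Proof.
move=> yr; rewrite -subr_ge0.
have -> : y ^+ 2 - (2 * y - 1) = (y - 1) ^+ 2 by ring.
by rewrite real_exprn_even_ge0 // rpredB ?rpred1.
Qed.

Section Bessel.
Variables (C : numClosedFieldType) (I : finType) (m n : nat) (M : I -> 'M[C]_(m, n)).

Definition orthonormal_mx := forall k l, \tr (M k *m adj (M l)) = (k == l)%:R.

Lemma bessel (X : 'M[C]_(m, n)) : orthonormal_mx ->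
  \sum_k `|\tr (X *m adj (M k))| ^+ 2 <= hsnorm2 X.
Proof.
move=> orth; set c := fun k => \tr (X *m adj (M k)).
pose Z := \sum_k c k *: M k.
have XZ : \tr (X *m adj Z) = \sum_k `|c k| ^+ 2.
  rewrite adj_sum mulmx_sumr raddf_sum; apply: eq_bigr => k _ /=.
  by rewrite adjZ -scalemxAr mxtraceZ normCK mulrC.
have ZM k : \tr (Z *m adj (M k)) = c k.
  rewrite mulmx_suml raddf_sum -[RHS](sum_delta c); apply: eq_bigr => j _ /=.
  by rewrite -scalemxAl mxtraceZ orth eq_sym.
have ZZ : \tr (Z *m adj Z) = \sum_k `|c k| ^+ 2.
  rewrite [adj Z]adj_sum mulmx_sumr raddf_sum; apply: eq_bigr => k _ /=.
  by rewrite adjZ -scalemxAr mxtraceZ ZM normCK mulrC.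
have ZX : \tr (Z *m adj X) = \sum_k `|c k| ^+ 2.
  rewrite -[Z *m adj X]adjK trace_adj adjM adjK XZ rmorph_sum; apply: eq_bigr => k _.
  by rewrite /= rmorphXn /= conj_normC.
have := hsnorm2_ge0 (X - Z).
rewrite /hsnorm2 adjB mulmxBl !mulmxBr !mxtraceB XZ ZZ ZX subrr subr0.
by rewrite subr_ge0.
Qed.

End Bessel.

(** * One-shot decoupling and the explicit decoder *)

Section OneShot.
Variables (C : numClosedFieldType) (I : finType) (m n L : nat).
Variables (M : I -> 'M[C]_(m, n)) (lam : I -> C) (beta : 'I_n -> C).
Variables (T : pred I) (Tb : pred 'I_n) (lmin mu : C).
Hypotheses (lam_ge0 : forall k, 0 <= lam k) (lam_sum : \sum_k lam k = 1).
Hypothesis orth : orthonormal_mx M.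
Hypothesis marg : \sum_k lam k *: (adj (M k) *m M k) = diag_mx (\row_b beta b).
Hypotheses (lmin_gt0 : 0 < lmin) (lam_typ : forall k, T k -> lmin <= lam k).
Hypothesis beta_typ : forall b, Tb b -> beta b <= mu.
Hypothesis mu_ge0 : 0 <= mu.
Hypothesis L_gt0 : (0 < L)%N.

Let P : 'M[C]_n := diag_mx (\row_b (Tb b)%:R).
(** The [M k] are the eigenvectors of the state in matrix form and [beta] is the spectrum of the
    decoding party's marginal. [B k l] is the partial trace, over the decoder, of the operator
    linking eigenvectors [k] and [l] after the decoder has been projected on the typical
    subspace. *)
Let B k l := M k *m P *m adj (M l).
Let S := {ffun 'I_L * 'I_m -> bool}.
Let card : C := #|{: S}|%:R.

Let card_gt0 : 0 < card.
Proof. by rewrite ltr0n card_ffun expn_gt0 card_bool. Qed.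
Let LC_gt0 : 0 < L%:R :> C. Proof. by rewrite ltr0n. Qed.

Lemma proj_idem : P *m P = P.
Proof.
by rewrite mulmx_diag; congr diag_mx; apply/rowP => b; rewrite !mxE -natrM mulnb andbb.
Qed.

Lemma adj_proj : adj P = P.
Proof. by apply: adj_diag_real => k; rewrite mxE realn. Qed.

Lemma beta_ge0 b : 0 <= beta b.
Proof.
have <- : diag_mx (\row_b beta b) b b = beta b by rewrite !mxE eqxx.
rewrite -marg summxE sumr_ge0 // => k _; rewrite !mxE mulr_ge0 // sumr_ge0 // => a _.
by rewrite adjE mulrC -normCK exprn_ge0.
Qed.

Lemma beta_sum : \sum_b beta b = 1.
Proof.
transitivity (\tr (diag_mx (\row_b beta b))).
  by rewrite mxtrace_diag; apply: eq_bigr => b _; rewrite mxE.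
rewrite -marg raddf_sum -lam_sum; apply: eq_bigr => k _ /=.
by rewrite mxtraceZ mxtrace_mulC orth eqxx mulr1.
Qed.

Lemma traceB_hsnorm2 k : \tr (B k k) = hsnorm2 (M k *m P).
Proof. by rewrite /hsnorm2 adjM adj_proj !mulmxA -(mulmxA (M k) P P) proj_idem. Qed.

Lemma traceB_le1 k : \tr (B k k) <= 1.
Proof.
have -> : 1 = hsnorm2 (M k) by rewrite /hsnorm2 orth eqxx.
rewrite traceB_hsnorm2 !hsnorm2E; apply: ler_sum => a _; apply: ler_sum => b _.
rewrite mul_mx_diag !mxE; case: (Tb b); rewrite ?mulr1 ?mulr0 //.
by rewrite normr0 expr0n exprn_ge0.
Qed.

Lemma weighted_traceB : \sum_k lam k * \tr (B k k) = \sum_(b | Tb b) beta b.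
Proof.
transitivity (\tr ((\sum_k lam k *: (adj (M k) *m M k)) *m P)).
  rewrite mulmx_suml raddf_sum; apply: eq_bigr => k _ /=.
  by rewrite -scalemxAl mxtraceZ -mulmxA mxtrace_mulC.
rewrite marg mulmx_diag mxtrace_diag [RHS]big_mkcond; apply: eq_bigr => b _.
by rewrite !mxE; case: (Tb b); rewrite ?mulr1 ?mulr0.
Qed.

Lemma typical_traceB_ge :
  1 - (\sum_(k | ~~ T k) lam k + \sum_(b | ~~ Tb b) beta b)
  <= \sum_(k | T k) lam k * \tr (B k k).
Proof.
have h1 := weighted_traceB; rewrite (bigID T) /= in h1.
have h2 := beta_sum; rewrite (bigID Tb) /= in h2.
have h3 : \sum_(k | ~~ T k) lam k * \tr (B k k) <= \sum_(k | ~~ T k) lam k.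
  by apply: ler_sum => k _; rewrite ler_piMr ?traceB_le1.
move: h1 h2 h3; set a := \sum_(k | T k) _; set t := \sum_(k | ~~ T k) lam k.
set b' := \sum_(b | ~~ Tb b) _; set a' := \sum_(k | _) _ => h1 h2 h3.
have -> : 1 - (t + b') = a + (a' - t) by rewrite -h2 -h1; ring.
by rewrite gerDl subr_le0.
Qed.

(** The double sum reassembles two copies of [marg]: it is the purity of the projected marginal. *)
Lemma weighted_hsnorm2B :
  \sum_k \sum_l lam k * lam l * hsnorm2 (B k l) = \sum_(b | Tb b) beta b ^+ 2.
Proof.
transitivity (\tr (P *m diag_mx (\row_b beta b) *m P *m diag_mx (\row_b beta b))).
  rewrite -{1}marg mulmx_sumr !mulmx_suml raddf_sum; apply: eq_bigr => k _ /=.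
  rewrite -marg mulmx_sumr raddf_sum; apply: eq_bigr => l _ /=.
  rewrite -!scalemxAr -!scalemxAl !mxtraceZ mulrA [lam k * _]mulrC; congr (_ * _).
  rewrite /hsnorm2 /B !adjM adjK adj_proj.
  rewrite mulmxA mxtrace_mulC !mulmxA.
  by rewrite -!mulmxA mxtrace_mulC -!mulmxA.
rewrite !mulmx_diag mxtrace_diag [RHS]big_mkcond; apply: eq_bigr => b _.
by rewrite !mxE; case: (Tb b); rewrite ?mul1r ?mulr1 ?mul0r ?mulr0 ?expr2.
Qed.

(** The missing weight [lam l] is at least [lmin] on typical [l], which costs a division by [lmin];
    the purity is at most [mu] because each typical [beta b] is. This is the origin of the ratio
    [mu / lmin]. *)
Lemma typical_hsnorm2B_le :
  \sum_(k | T k) \sum_(l | T l) lam k * hsnorm2 (B k l) <= mu / lmin.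
Proof.
rewrite ler_pdivlMr //.
apply: (@le_trans _ _ (\sum_k \sum_l lam k * lam l * hsnorm2 (B k l))).
  rewrite big_distrl /= [leRHS](bigID T) /= -[leLHS]addr0 lerD //; last first.
    apply: sumr_ge0 => k _; apply: sumr_ge0 => l _.
    by rewrite !mulr_ge0 ?hsnorm2_ge0.
  apply: ler_sum => k _; rewrite big_distrl /= [leRHS](bigID T) /= -[leLHS]addr0 lerD //.
    apply: ler_sum => l Tl; rewrite mulrAC ler_wpM2r ?hsnorm2_ge0 //.
    by rewrite ler_wpM2l ?lam_typ.
  by apply: sumr_ge0 => l _; rewrite !mulr_ge0 ?hsnorm2_ge0.
rewrite weighted_hsnorm2B.
apply: (@le_trans _ _ (\sum_(b | Tb b) beta b * mu)).
  by apply: ler_sum => b Tb_b; rewrite expr2 ler_wpM2l ?beta_ge0 ?beta_typ.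
rewrite -big_distrl /=.
rewrite ler_piMl // -beta_sum [leRHS](bigID Tb) /= lerDl sumr_ge0 // => b _.
exact: beta_ge0.
Qed.

Section Decoder.
Variable s : S.
Let g : 'M[C]_(L, m) := signmx C s.
Let U k : 'M[C]_(L, n) := if T k then g *m M k *m P else 0.
Let Q := \sum_k adj (U k) *m U k.
Let G := invmx (1%:M + Q).

(* The ideal decoder is [U^dagger], only approximately an isometry. The contraction
   [2 U (1 + Q)^-1] is close to it, and the Cayley transform [(1 - Q) (1 + Q)^-1] completes
   it to an instrument. *)
Definition decoder (x : I + 'I_n) : 'M[C]_(L, n) :=
  match x with
  | inl k => map_mx Num.conj (2 *: (U k *m G))
  | inr b => delta_mx (Ordinal L_gt0) b *m map_mx Num.conj ((1%:M - Q) *m G)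
  end.

Lemma adj_conjM p q r (X : 'M[C]_(p, q)) (Y : 'M[C]_(p, r)) :
  adj (map_mx Num.conj X) *m map_mx Num.conj Y = map_mx Num.conj (adj X *m Y).
Proof. by rewrite map_mxM adj_conj. Qed.

Lemma decoder_complete : \sum_x adj (decoder x) *m decoder x = 1%:M.
Proof.
rewrite big_sumType /=.
have -> : \sum_(k : I) adj (decoder (inl k)) *m decoder (inl k) =
   map_mx Num.conj (\sum_k adj (2 *: (U k *m G)) *m (2 *: (U k *m G))).
  by rewrite raddf_sum; apply: eq_bigr => k _; rewrite adj_conjM.
have -> : \sum_(b < n) adj (decoder (inr b)) *m decoder (inr b) =
   map_mx Num.conj (adj ((1%:M - Q) *m G) *m ((1%:M - Q) *m G)).
  rewrite -adj_conjM /=; set X := map_mx _ _.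
  transitivity (adj X *m (\sum_b delta_mx b b) *m X); last first.
    by rewrite -mx1_sum_delta mulmx1.
  rewrite mulmx_sumr mulmx_suml; apply: eq_bigr => b _.
  rewrite adjM /adj map_delta_mx trmx_delta !mulmxA -(mulmxA _ (delta_mx b _)).
  by rewrite mul_delta_mx.
by rewrite -map_mxD cayley_complete map_mx1.
Qed.

(** Each [U k] ends in [P], so [P] acts as the identity on [Q] from both sides and commutes with
    [1 + Q], hence with its inverse. *)
Lemma gram_inv_proj : G *m P = P *m G.
Proof.
have UP k : U k *m P = U k.
  by rewrite /U; case: (T k); rewrite ?mul0mx // -(mulmxA (g *m M k)) proj_idem.
have QP : Q *m P = Q.
  by rewrite mulmx_suml; apply: eq_bigr => k _; rewrite -mulmxA UP.
have aQ : adj Q = Q := adj_gram U.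
have PQ : P *m Q = Q.
  by rewrite -[P *m Q]adjK adjM adj_proj aQ QP aQ.
have uA : 1%:M + Q \in unitmx by exact: gram1_unit.
have AP : (1%:M + Q) *m P = P *m (1%:M + Q).
  by rewrite mulmxDl mulmxDr mul1mx mulmx1 QP PQ.
by rewrite -[LHS]mulmx1 -(mulmxV uA) !mulmxA -(mulmxA G P) -AP mulmxA mulVmx // mul1mx.
Qed.

Let q k := \tr (U k *m G *m adj (U k)).

Lemma overlap_ge0 k : 0 <= q k. Proof. exact: trace_gram_inv_ge0. Qed.

(** The second party's operators act through their transpose, which the conjugation in [decoder]
    turns into an adjoint. The projection contained in [adj (U k)] then moves through [G] and
    completes [g *m M k] to [U k]. *)
Lemma decoder_trace k : T k -> \tr (g *m M k *m (decoder (inl k))^T) = 2 * q k.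
Proof.
move=> Tk; rewrite /= -/(adj _) adjZ conjC_nat -scalemxAr mxtraceZ; congr (_ * _).
rewrite /q adjM adj_gram_inv.
have UP : adj (U k) = P *m adj (U k).
  by rewrite -[P in RHS]adj_proj -adjM /U Tk -(mulmxA (g *m M k) P P) proj_idem.
have UE : U k = g *m M k *m P by rewrite /U Tk.
rewrite [in LHS]UP [G *m (P *m _)]mulmxA gram_inv_proj.
by rewrite [X in _ = \tr (X *m _ *m _)]UE !mulmxA.
Qed.

(** This is [trace_gram_inv_ge] at [X = U k], rewritten with
    [U k *m adj (U l) = g *m B k l *m adj g]. The inverse is gone: the left side has degree at most
    four in the signs and can be averaged. *)
Lemma overlap_ge k : T k ->
  3 * \tr (g *m B k k *m adj g) - \sum_(l | T l) hsnorm2 (g *m B k l *m adj g)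
  <= 4 * q k.
Proof.
move=> Tk; have := trace_gram_inv_ge U (U k); rewrite trace_gram -/Q -/G -/(q k).
have UU l : T l -> U k *m adj (U l) = g *m B k l *m adj g.
  move=> Tl; rewrite /U Tk Tl !adjM adj_proj /B !mulmxA.
  by rewrite -(mulmxA _ P P) proj_idem.
rewrite {1}/hsnorm2 UU //; congr (_ - _ <= _).
rewrite [RHS]big_mkcond; apply: eq_bigr => l _; case: ifP => Tl; first by rewrite UU.
by rewrite /U Tl adj0 mulmx0 /hsnorm2 mul0mx mxtrace0.
Qed.

End Decoder.

Let c : C := sqrtC (card * L%:R)^-1.
Let cc : c * c = (card * L%:R)^-1.
Proof. by rewrite -expr2 sqrtCK. Qed.
Let c_ge0 : 0 <= c.
Proof. by rewrite sqrtC_ge0 invr_ge0 mulr_ge0 ?ler0n. Qed.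

(** The scale [c] compensates the factor [card * L] of [sum_signmx_gram], so that the sign matrices
    become Kraus operators. *)
Definition encoder (s : S) : 'M[C]_(L, m) := c *: signmx C s.

Lemma encoder_complete : \sum_(s : S) adj (encoder s) *m encoder s = 1%:M.
Proof.
transitivity ((c * c) *: (\sum_(s : S) adj (signmx C s) *m signmx C s)).
  rewrite scaler_sumr; apply: eq_bigr => s _.
  by rewrite adjZ -scalemxAl -scalemxAr scalerA (CrealP (ger0_real c_ge0)).
rewrite sum_signmx_gram -/S -/card cc -scalemx1 scalerA mulVf ?scale1r //.
by rewrite mulf_neq0 // gt_eqF.
Qed.

(** For eigenvector [k] only the decoder outcome [inl k] is kept; all other terms are nonnegative.
    The loss collects the atypical weight of both spectra and the decoupling error
    [L * mu / lmin]. *)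
Theorem one_shot_fidelity :
  1 - 2 * (\sum_(k | ~~ T k) lam k + \sum_(b | ~~ Tb b) beta b + L%:R * (mu / lmin))
  <= \sum_(s : S) \sum_x \sum_k
       lam k * (`|\tr (encoder s *m M k *m (decoder s x)^T)| ^+ 2 / L%:R).
Proof.
pose U (s : S) k : 'M[C]_(L, n) := if T k then signmx C s *m M k *m P else 0.
pose q (s : S) k : C := \tr (U s k *m invmx (1%:M + \sum_l adj (U s l) *m U s l) *m adj (U s k)).
have LL : 0 < card * L%:R by rewrite mulr_gt0.
have term_ge0 (s : S) x k :
    0 <= lam k * (`|\tr (encoder s *m M k *m (decoder s x)^T)| ^+ 2 / L%:R).
  by rewrite mulr_ge0 ?lam_ge0 // divr_ge0 ?ler0n // exprn_ge0.
have step1 : \sum_(s : S) \sum_(k | T k) lam k * ((4 * q s k / L%:R - 1) / card) <=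
    \sum_(s : S) \sum_x \sum_k
       lam k * (`|\tr (encoder s *m M k *m (decoder s x)^T)| ^+ 2 / L%:R).
  have split (f : I + 'I_n -> C) :
      \sum_x f x = \sum_k f (inl k) + \sum_b f (inr b) by rewrite big_sumType.
  apply: ler_sum => s _; rewrite split -[leLHS]addr0 lerD //; last first.
    by apply: sumr_ge0 => b _; apply: sumr_ge0 => k _; exact: (term_ge0 s (inr b)).
  rewrite [leLHS]big_mkcond; apply: ler_sum => k _; case: ifP => Tk; last first.
    by apply: sumr_ge0 => l _; exact: (term_ge0 s (inl k)).
  rewrite (bigD1 k) // -[leLHS]addr0 lerD //; last first.
    by apply: sumr_ge0 => l _; exact: (term_ge0 s (inl k)).
  rewrite ler_wpM2l // /encoder -!scalemxAl mxtraceZ.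
  rewrite decoder_trace // -/(U s k).
  rewrite -[\tr _]/(q s k).
  have qs : 0 <= q s k by exact: overlap_ge0.
  have e : `|c * (2 * q s k)| ^+ 2 / L%:R = (2 * q s k / L%:R) ^+ 2 / card.
    rewrite ger0_norm ?mulr_ge0 ?ler0n // exprMn [c ^+ 2]expr2 cc.
    by field; rewrite !gt_eqF.
  rewrite e ler_wpM2r ?invr_ge0 ?ler0n //.
  (* The tangent bound is applied to [y = 2 * q s k / L], whose ideal value is the point of contact
     [y = 1]. *)
  have -> : 4 * q s k / L%:R = 2 * (2 * q s k / L%:R).
    by field; rewrite gt_eqF.
  by rewrite sqr_ge_tangent // ger0_real // !mulr_ge0 ?invr_ge0 ?ler0n.
apply: le_trans step1; rewrite exchange_big /=.
have sumq k : T k -> card * L%:R * (2 * \tr (B k k) - 2 * L%:R * \sum_(l | T l) hsnorm2 (B k l))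
    <= \sum_(s : S) 4 * q s k.
  move=> Tk.
  apply: (@le_trans _ _ (\sum_(s : S) (3 * \tr (signmx C s *m B k k *m adj (signmx C s))
     - \sum_(l | T l) hsnorm2 (signmx C s *m B k l *m adj (signmx C s))))); last first.
    by apply: ler_sum => s _; exact: overlap_ge.
  rewrite sumrB -big_distrr /= sum_signmx_trace -/S -/card [X in _ <= _ - X]exchange_big /=.
  have h : \sum_(l | T l) \sum_(s : S) hsnorm2 (signmx C s *m B k l *m adj (signmx C s)) <=
      card * (L%:R * \tr (B k k) + 2 * L%:R ^+ 2 * \sum_(l | T l) hsnorm2 (B k l)).
    apply: (@le_trans _ _ (\sum_(l | T l)
       card * (L%:R * `|\tr (B k l)| ^+ 2 + 2 * L%:R ^+ 2 * hsnorm2 (B k l)))).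
      by apply: ler_sum => l _; exact: sum_signmx_hsnorm2.
    rewrite -big_distrr /= big_split /= -!big_distrr /=.
    rewrite ler_wpM2l ?ler0n // lerD2r ler_wpM2l ?ler0n // traceB_hsnorm2.
    (* Bessel bounds the sum over [l] of [|\tr (B k l)|^2] by [\tr (B k k)]. This uses up one of the
       three copies supplied by [overlap_ge], so two remain. *)
    apply: le_trans (bessel (M k *m P) orth).
    rewrite [leRHS](bigID T) /= lerDl sumr_ge0 // => l _; exact: exprn_ge0.
  apply: (le_trans _ (lerB (lexx _) h)).
  by rewrite le_eqVlt; apply/orP; left; apply/eqP; ring.
have -> : \sum_(k | T k) \sum_(s : S) lam k * ((4 * q s k / L%:R - 1) / card) =
   \sum_(k | T k) lam k * ((\sum_(s : S) 4 * q s k) / (card * L%:R)) - \sum_(k | T k) lam k.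
  rewrite -sumrB; apply: eq_bigr => k _; rewrite -big_distrr /= -big_distrl /=.
  rewrite sumrB -big_distrl /= sumr_const -[_ *+ #|_|]/card.
  by field; rewrite !gt_eqF.
apply: (@le_trans _ _ (\sum_(k | T k) lam k *
     (2 * \tr (B k k) - 2 * L%:R * \sum_(l | T l) hsnorm2 (B k l)) - 1)); last first.
  apply: lerB.
    apply: ler_sum => k Tk; rewrite ler_wpM2l // ler_pdivlMr // mulrC; exact: sumq.
  by rewrite -lam_sum [leRHS](bigID T) /= lerDl sumr_ge0.
have -> : \sum_(k | T k) lam k *
     (2 * \tr (B k k) - 2 * L%:R * \sum_(l | T l) hsnorm2 (B k l)) =
   2 * (\sum_(k | T k) lam k * \tr (B k k)
        - L%:R * \sum_(k | T k) \sum_(l | T l) lam k * hsnorm2 (B k l)).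
  rewrite mulrBr mulrA !big_distrr -sumrB /=; apply: eq_bigr => k _.
  by rewrite -big_distrr /=; ring.
have -> : 1 - 2 * (\sum_(k | ~~ T k) lam k + \sum_(b | ~~ Tb b) beta b + L%:R * (mu / lmin))
  = 2 * ((1 - (\sum_(k | ~~ T k) lam k + \sum_(b | ~~ Tb b) beta b)) - L%:R * (mu / lmin)) - 1.
  by ring.
rewrite lerD2r ler_wpM2l ?ler0n //; apply: lerB; first exact: typical_traceB_ge.
by rewrite ler_wpM2l ?ler0n // typical_hsnorm2B_le.
Qed.

End OneShot.

(** * Tensor powers and bipartite indices *)

Section Digits.
Variables (d N : nat).

Lemma digit_lt (a : 'I_(d ^ N)) (k : 'I_N) : (digit d k a < d)%N.
Proof.
rewrite ltn_mod; have : (0 < d ^ N)%N by exact: leq_ltn_trans (leq0n a) (ltn_ord a).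
have N0 : (0 < N)%N by exact: leq_ltn_trans (leq0n k) (ltn_ord k).
by rewrite expn_gt0 => /orP [//|/eqP e]; rewrite e in N0.
Qed.

Definition digits (a : 'I_(d ^ N)) : {ffun 'I_N -> 'I_d} :=
  [ffun k => Ordinal (digit_lt a k)].

(** Induction on the length: the quotient by [d ^ M] is the top digit, and the remainder keeps all
    lower digits. *)
Lemma digits_inj : injective digits.
Proof.
move=> a b eab; apply/val_inj => /=.
have {eab} : forall k, (k < N)%N -> digit d k a = digit d k b.
  by move=> k kN; have /ffunP/(_ (Ordinal kN)) := eab; rewrite !ffunE => -[].
have := ltn_ord b; have := ltn_ord a; move: (val a) (val b) => {a b}.
elim: N => [|M IH] a b; first by rewrite expn0 !ltnS !leqn0 => /eqP -> /eqP ->.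
case: (posnP d) => [->|d0]; first by rewrite exp0n.
move=> aM bM h; rewrite (divn_eq a (d ^ M)) (divn_eq b (d ^ M)).
have hM : (0 < d ^ M)%N by rewrite expn_gt0 d0.
have small x : (x < d ^ M.+1)%N -> (x %/ d ^ M = digit d M x)%N.
  by move=> xM; rewrite /digit modn_small // ltn_divLR // -expnS.
congr (_ * _ + _)%N; first by rewrite !small // h.
apply: IH; rewrite ?ltn_mod // => k kM.
have digm x : digit d k (x %% d ^ M) = digit d k x.
  rewrite /digit {2}(divn_eq x (d ^ M)).
  have -> : (d ^ M = d ^ (M - k.+1) * d * d ^ k)%N.
    by rewrite -expnSr -expnD subnSK // subnK // ltnW.
  by rewrite mulnA divnMDl ?expn_gt0 ?d0 // mulnA modnMDl.
by rewrite !digm h // ltnS ltnW.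
Qed.

Lemma digits_bij : bijective digits.
Proof. by apply: inj_card_bij digits_inj _; rewrite card_ffun !card_ord. Qed.

Lemma sum_digits (V : nmodType) (F : {ffun 'I_N -> 'I_d} -> V) :
  \sum_(a < d ^ N) F (digits a) = \sum_t F t.
Proof. by rewrite (reindex digits) //; apply: onW_bij digits_bij. Qed.

Lemma sum_prod_digits (R : comPzSemiRingType) (F : 'I_N -> 'I_d -> R) :
  \sum_(a < d ^ N) \prod_k F k (digits a k) = \prod_k \sum_i F k i.
Proof. by rewrite bigA_distr_bigA -sum_digits. Qed.

End Digits.

Section TensorPower.
Variables (C : numClosedFieldType) (N : nat).

(** The tensor product of possibly different factors, with rows and columns read in base [m] and [n]
    exactly as [prodstate] reads its indices. *)
Definition tpow m n (X : 'I_N -> 'M[C]_(m, n)) : 'M[C]_(m ^ N, n ^ N) :=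
  \matrix_(a, b) \prod_k X k (digits a k) (digits b k).

Lemma tpowM m n p (X : 'I_N -> 'M[C]_(m, n)) (Y : 'I_N -> 'M[C]_(n, p)) :
  tpow X *m tpow Y = tpow (fun k => X k *m Y k).
Proof.
apply/matrixP => a b; rewrite mxE [RHS]mxE.
transitivity (\sum_(i < n ^ N)
    \prod_k (X k (digits a k) (digits i k) * Y k (digits i k) (digits b k))).
  by apply: eq_bigr => i _; rewrite 2!mxE -big_split.
rewrite (sum_prod_digits (fun k i => X k (digits a k) i * Y k i (digits b k))).
by apply: eq_bigr => k _; rewrite mxE.
Qed.

Lemma tpow_tr m n (X : 'I_N -> 'M[C]_(m, n)) : (tpow X)^T = tpow (fun k => (X k)^T).
Proof. by apply/matrixP => a b; rewrite !mxE; apply: eq_bigr => k _; rewrite mxE. Qed.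

Lemma tpow_adj m n (X : 'I_N -> 'M[C]_(m, n)) : adj (tpow X) = tpow (fun k => adj (X k)).
Proof.
by apply/matrixP => a b; rewrite !mxE rmorph_prod; apply: eq_bigr => k _; rewrite adjE.
Qed.

Lemma tpow_trace n (X : 'I_N -> 'M[C]_n) : \tr (tpow X) = \prod_k \tr (X k).
Proof.
rewrite -(sum_prod_digits (fun k i => X k i i)); apply: eq_bigr => a _.
by rewrite mxE.
Qed.

Lemma tpow_diag n (d : 'I_N -> 'I_n -> C) :
  tpow (fun k => diag_mx (\row_i d k i)) = diag_mx (\row_b \prod_k d k (digits b k)).
Proof.
apply/matrixP => a b; rewrite !mxE; case: eqVneq => [<-|nab].
  by rewrite mulr1n; apply: eq_bigr => k _; rewrite !mxE eqxx.
rewrite mulr0n; apply/eqP; rewrite prodf_seq_eq0.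
have [/existsP [k hk]|/existsPn h] := boolP [exists k, digits a k != digits b k].
  by apply/hasP; exists k; rewrite ?mem_index_enum //= !mxE (negbTE hk).
case/eqP: nab; apply: digits_inj; apply/ffunP => k.
by apply/eqP; have := h k; rewrite negbK.
Qed.

Lemma tpow1 n : tpow (fun=> 1%:M : 'M[C]_n) = 1%:M.
Proof.
have e m : (1%:M : 'M[C]_m) = diag_mx (\row_b 1).
  by rewrite -diag_const_mx; congr diag_mx; apply/rowP => i; rewrite !mxE.
rewrite [1%:M in LHS]e [1%:M]e tpow_diag; congr diag_mx; apply/rowP => i; rewrite !mxE.
by rewrite big1.
Qed.

Lemma tpow_sum n m r (c : 'I_r -> C) (X : 'I_r -> 'M[C]_(m, n)) :
  tpow (fun=> \sum_i c i *: X i) =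
  \sum_(t : {ffun 'I_N -> 'I_r}) (\prod_k c (t k)) *: tpow (fun k => X (t k)).
Proof.
apply/matrixP => a b; rewrite summxE mxE.
under eq_bigr do rewrite summxE.
rewrite bigA_distr_bigA /=; apply: eq_bigr => t _; rewrite !mxE -big_split /=.
by apply: eq_bigr => k _; rewrite mxE.
Qed.

End TensorPower.

Section BipartiteIndex.
Variables (m n : nat).

Lemma pidx_lt (a : 'I_m) (b : 'I_n) : (a * n + b < m * n)%N.
Proof.
apply: leq_trans (_ : a * n + n <= _)%N; first by rewrite ltn_add2l.
by rewrite addnC -mulSn leq_mul2r ltn_ord orbT.
Qed.

Definition pidx a b : 'I_(m * n) := Ordinal (pidx_lt a b).

Lemma pidx_div a b : (pidx a b %/ n = a)%N.
Proof. by rewrite /= divnMDl ?(leq_ltn_trans _ (ltn_ord b)) // divn_small ?addn0. Qed.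

Lemma pidx_mod a b : (pidx a b %% n = b)%N.
Proof. by rewrite /= modnMDl modn_small. Qed.

Lemma pidx_bij : bijective (fun ab : 'I_m * 'I_n => pidx ab.1 ab.2).
Proof.
apply: inj_card_bij; last by rewrite card_prod !card_ord.
move=> [a b] [a' b'] /= e; congr pair; apply: ord_inj.
  by rewrite -(pidx_div a b) e pidx_div.
by rewrite -(pidx_mod a b) e pidx_mod.
Qed.

Lemma sum_pidx (V : nmodType) (F : 'I_(m * n) -> V) :
  \sum_x F x = \sum_a \sum_b F (pidx a b).
Proof.
rewrite pair_big (reindex (fun ab : 'I_m * 'I_n => pidx ab.1 ab.2)) //.
by apply: onW_bij pidx_bij.
Qed.

Lemma pidxP (x : 'I_(m * n)) : exists a b, x = pidx a b.
Proof. by case: pidx_bij => f _ fK; exists (f x).1, (f x).2; rewrite fK. Qed.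

Lemma eq_pidx a b a' b' : (pidx a b == pidx a' b') = (a == a') && (b == b').
Proof.
rewrite -xpair_eqE; apply/eqP/eqP => [|[-> -> //]].
exact: (bij_inj pidx_bij (x1 := (a, b)) (x2 := (a', b'))).
Qed.

End BipartiteIndex.

Lemma mentryE (T : nmodType) m n (A : 'M[T]_(m, n)) (i : 'I_m) (j : 'I_n) :
  mentry A i j = A i j.
Proof. by rewrite /mentry !valK. Qed.

Section Bipartite.
Variables (R : realType).
Local Notation C := R[i].

Lemma adjmxE m n (A : 'M[C]_(m, n)) : adjmx A = adj A. Proof. by []. Qed.

(** The coefficient matrix of a bipartite vector. In this form both reduced states of a pure state
    are Gram matrices, and local operators become multiplication from one side. *)
Definition unvec m n (v : 'cV[C]_(m * n)) : 'M[C]_(m, n) := \matrix_(a, b) v (pidx a b) 0.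

Definition vec m n (A : 'M[C]_(m, n)) : 'cV[C]_(m * n) :=
  \col_x mentry A (x %/ n) (x %% n).

Lemma vecE m n (A : 'M[C]_(m, n)) a b : vec A (pidx a b) 0 = A a b.
Proof. by rewrite mxE pidx_div pidx_mod mentryE. Qed.

Lemma vecK m n : cancel (@vec m n) (@unvec m n).
Proof. by move=> A; apply/matrixP => a b; rewrite mxE vecE. Qed.

Lemma unvecK m n : cancel (@unvec m n) (@vec m n).
Proof.
move=> v; apply/colP => x; have [a [b ->]] := pidxP x; by rewrite vecE mxE.
Qed.

Lemma inner_unvec m n (v w : 'cV[C]_(m * n)) :
  (adjmx v *m w) 0 0 = \tr (unvec w *m adj (unvec v)).
Proof.
rewrite adjmxE mxE sum_pidx; apply: eq_bigr => a _; rewrite mxE; apply: eq_bigr => b _.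
by rewrite !adjE !mxE mulrC.
Qed.

Lemma ketbraE n (v : 'cV[C]_n) x y : ketbra v x y = v x 0 * (v y 0)^*.
Proof. by rewrite /ketbra adjmxE mxE big_ord1 adjE. Qed.

Lemma ptrBE dA dB (rho : 'M[C]_(dA * dB)) a a' :
  ptrB dA dB rho a a' = \sum_b rho (pidx a b) (pidx a' b).
Proof. by rewrite mxE; apply: eq_bigr => b _; rewrite -(mentryE rho). Qed.

Lemma ptrAE dA dB (rho : 'M[C]_(dA * dB)) b b' :
  ptrA dA dB rho b b' = \sum_a rho (pidx a b) (pidx a b').
Proof. by rewrite mxE; apply: eq_bigr => a _; rewrite -(mentryE rho). Qed.

Lemma ptrB_ketbra dA dB (v : 'cV[C]_(dA * dB)) :
  ptrB dA dB (ketbra v) = unvec v *m adj (unvec v).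
Proof.
apply/matrixP => a a'; rewrite ptrBE mxE; apply: eq_bigr => b _.
by rewrite ketbraE adjE !mxE.
Qed.

Lemma ptrA_ketbra dA dB (v : 'cV[C]_(dA * dB)) :
  ptrA dA dB (ketbra v) = (unvec v)^T *m adj (unvec v)^T.
Proof.
apply/matrixP => a a'; rewrite ptrAE mxE; apply: eq_bigr => b _.
by rewrite ketbraE adjE !mxE.
Qed.

Lemma ptrB_lin dA dB (I : finType) (c : I -> C) (rho : I -> 'M[C]_(dA * dB)) :
  ptrB dA dB (\sum_i c i *: rho i) = \sum_i c i *: ptrB dA dB (rho i).
Proof.
apply/matrixP => a a'; rewrite ptrBE summxE; under eq_bigr do rewrite summxE.
rewrite exchange_big; apply: eq_bigr => i _ /=; rewrite mxE ptrBE big_distrr.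
by apply: eq_bigr => b _; rewrite mxE.
Qed.

Lemma ptrA_lin dA dB (I : finType) (c : I -> C) (rho : I -> 'M[C]_(dA * dB)) :
  ptrA dA dB (\sum_i c i *: rho i) = \sum_i c i *: ptrA dA dB (rho i).
Proof.
apply/matrixP => a a'; rewrite ptrAE summxE; under eq_bigr do rewrite summxE.
rewrite exchange_big; apply: eq_bigr => i _ /=; rewrite mxE ptrAE big_distrr.
by apply: eq_bigr => b _; rewrite mxE.
Qed.

Lemma kronE m1 n1 m2 n2 (A : 'M[C]_(m1, n1)) (B : 'M[C]_(m2, n2)) x1 x2 y1 y2 :
  kron A B (pidx x1 x2) (pidx y1 y2) = A x1 y1 * B x2 y2.
Proof. by rewrite mxE !pidx_div !pidx_mod !mentryE. Qed.

Lemma unvec_kronA dA dA1 dB (K : 'M[C]_(dA1, dA)) (v : 'cV[C]_(dA * dB)) :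
  unvec (kron K (1%:M : 'M[C]_dB) *m v) = K *m unvec v.
Proof.
apply/matrixP => a b; rewrite !mxE sum_pidx; apply: eq_bigr => a' _.
rewrite mxE -[RHS](sum_delta (fun b' => K a a' * v (pidx a' b') 0)).
by apply: eq_bigr => b' _; rewrite kronE mxE mulrAC.
Qed.

Lemma unvec_kronB dA dB dB1 (K : 'M[C]_(dB1, dB)) (v : 'cV[C]_(dA * dB)) :
  unvec (kron (1%:M : 'M[C]_dA) K *m v) = unvec v *m K^T.
Proof.
apply/matrixP => a b; rewrite !mxE sum_pidx exchange_big; apply: eq_bigr => b' _ /=.
rewrite !mxE -[RHS](sum_delta (fun a' => v (pidx a' b') 0 * K b b')).
by apply: eq_bigr => a' _; rewrite kronE mxE; ring.
Qed.

Lemma conj_ketbra m n (A : 'M[C]_(m, n)) (v : 'cV[C]_n) :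
  A *m ketbra v *m adjmx A = ketbra (A *m v).
Proof. by rewrite /ketbra !adjmxE adjM !mulmxA. Qed.

Lemma actA_mixture dA dA1 dB (K : 'M[C]_(dA1, dA)) (I : finType) (c : I -> C)
    (v : I -> 'cV[C]_(dA * dB)) :
  actA K (\sum_i c i *: ketbra (v i)) =
  \sum_i c i *: ketbra (vec (K *m unvec (v i))).
Proof.
rewrite /actA mulmx_sumr mulmx_suml; apply: eq_bigr => i _.
by rewrite -scalemxAr -scalemxAl conj_ketbra -unvec_kronA unvecK.
Qed.

Lemma actB_mixture dA dB dB1 (K : 'M[C]_(dB1, dB)) (I : finType) (c : I -> C)
    (v : I -> 'cV[C]_(dA * dB)) :
  actB K (\sum_i c i *: ketbra (v i)) =
  \sum_i c i *: ketbra (vec (unvec (v i) *m K^T)).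
Proof.
rewrite /actB mulmx_sumr mulmx_suml; apply: eq_bigr => i _.
by rewrite -scalemxAr -scalemxAl conj_ketbra -unvec_kronB unvecK.
Qed.

Lemma prodstateE dA dB N (sigma : 'I_N -> 'M[C]_(dA * dB)) a b a' b' :
  prodstate sigma (pidx a b) (pidx a' b') =
  \prod_k sigma k (pidx (digits a k) (digits b k)) (pidx (digits a' k) (digits b' k)).
Proof.
rewrite mxE !pidx_div !pidx_mod; apply: eq_bigr => k _.
by rewrite -[RHS]mentryE /= !ffunE.
Qed.

(** [prodstate] gathers all A digits and all B digits; in matrix form these are the row and the
    column of [tpow], so no permutation of tensor factors has to be written. *)
Lemma prodstate_ketbra dA dB N (v : 'I_N -> 'cV[C]_(dA * dB)) :
  prodstate (fun k => ketbra (v k)) = ketbra (vec (tpow (fun k => unvec (v k)))).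
Proof.
apply/matrixP => x y; have [a [b ->]] := pidxP x; have [a' [b' ->]] := pidxP y.
rewrite prodstateE ketbraE !vecE !mxE rmorph_prod -big_split /=.
by apply: eq_bigr => k _; rewrite ketbraE !mxE.
Qed.

Lemma prodstate_mixture dA dB N r (c : 'I_r -> C) (v : 'I_r -> 'cV[C]_(dA * dB)) :
  prodstate (fun _ : 'I_N => \sum_i c i *: ketbra (v i)) =
  \sum_(t : {ffun 'I_N -> 'I_r})
    (\prod_k c (t k)) *: ketbra (vec (tpow (fun k => unvec (v (t k))))).
Proof.
apply/matrixP => x y; have [a [b ->]] := pidxP x; have [a' [b' ->]] := pidxP y.
rewrite prodstateE summxE; under eq_bigr do rewrite summxE.
rewrite bigA_distr_bigA /=; apply: eq_bigr => t _.
rewrite mxE -prodstate_ketbra prodstateE -big_split /=.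
by apply: eq_bigr => k _; rewrite mxE.
Qed.

End Bipartite.

(** * Spectra and entropy *)

Lemma selfadjoint_spectral (C : numClosedFieldType) n (A : 'M[C]_n) : adj A = A ->
  exists (U : 'M[C]_n) (d : 'rV[C]_n), [/\ U *m adj U = 1%:M,
    forall k, d 0 k \is Num.real & A = U *m diag_mx d *m adj U].
Proof.
move=> hA; have hs : A \is hermitianmx n false (@Num.conj C).
  apply/is_hermitianmxP; rewrite expr0 scale1r.
  by rewrite -[LHS]hA /adj map_trmx.
have /orthomx_spectralP e := hermitian_normalmx hs.
have /mxOverP hr := hermitian_spectral_diag_real hs.
have uP := spectral_unitarymx A.
exists (adj (spectralmx A)), (spectral_diag A); split => [|k|].
- rewrite adjK; apply: mulmx1C; have /unitarymxP h := uP.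
  by rewrite -[RHS]h /adj map_trmx.
- exact: hr.
- by rewrite adjK {1}e invmx_unitary // /adj map_trmx.
Qed.

Section Spectrum.
Variable R : realType.
Local Notation C := R[i].
Local Open Scope complex_scope.

Lemma RtoC_sum (I : Type) (r : seq I) (P : pred I) (F : I -> R) :
  (\sum_(i <- r | P i) F i)%:C = \sum_(i <- r | P i) (F i)%:C.
Proof. exact: (raddf_sum (real_complex R)). Qed.

Lemma RtoC_prod (I : Type) (r : seq I) (P : pred I) (F : I -> R) :
  (\prod_(i <- r | P i) F i)%:C = \prod_(i <- r | P i) (F i)%:C.
Proof. exact: (rmorph_prod (real_complex R)). Qed.

Lemma RtoCM (x y : R) : (x * y)%:C = x%:C * y%:C.
Proof. exact: (rmorphM (real_complex R)). Qed.

Lemma RtoCD (x y : R) : (x + y)%:C = x%:C + y%:C.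
Proof. exact: (rmorphD (real_complex R)). Qed.

Lemma conj_RtoC (x : R) : (x%:C)^*%R = x%:C.
Proof. exact: conjc_real. Qed.

Definition sqn (z : C) : R := complex.Re z ^+ 2 + complex.Im z ^+ 2.

Lemma sqnE (z : C) : (sqn z)%:C = z * z^*%R.
Proof. by rewrite /sqn add_Re2_Im2 normCK. Qed.

Lemma sqn_ge0 z : 0 <= sqn z. Proof. by rewrite addr_ge0 ?sqr_ge0. Qed.

Lemma sqn_eq0 z : sqn z = 0 -> z = 0.
Proof.
move=> h; apply/eqP; rewrite -normr_eq0 -[_ == 0]/(true && (`|z| == 0)) -(expf_eq0 _ 2).
by rewrite normCK -sqnE h.
Qed.

Definition rdiag n (d : 'I_n -> R) : 'M[C]_n := diag_mx (\row_k (d k)%:C).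

Lemma adj_rdiag n (d : 'I_n -> R) : adj (rdiag d) = rdiag d.
Proof. by apply: adj_diag_real => k; rewrite mxE; apply/CrealP; rewrite conj_RtoC. Qed.

Lemma unitary_comm n (U : 'M[C]_n) : U *m adj U = 1%:M -> adj U *m U = 1%:M.
Proof. exact: mulmx1C. Qed.

Lemma herm_eigdec n (A : 'M[C]_n) : Defs.hermitian A -> exists d, eigdec A d.
Proof.
move=> /selfadjoint_spectral [U [d [hU hd e]]].
exists (fun k => complex.Re (d 0 k)), U; split=> //; rewrite {1}e.
by congr (_ *m diag_mx _ *m _); apply/rowP => k; rewrite mxE RRe_real.
Qed.

Lemma spec_eigdec n (A : 'M[C]_n) : Defs.hermitian A -> eigdec A (spec A).
Proof.
move=> /herm_eigdec h; rewrite /spec; case: pselect => // h'; exact: (proj2_sig (cid h')).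
Qed.

Lemma eigdec_herm n (A : 'M[C]_n) d : eigdec A d -> Defs.hermitian A.
Proof.
by case=> U [_ ->]; rewrite /Defs.hermitian !adjmxE !adjM adjK -/(rdiag d) adj_rdiag mulmxA.
Qed.

Lemma eigdec_trmx n (A : 'M[C]_n) d : eigdec A d -> eigdec A^T d.
Proof.
case=> U [hU ->]; exists (map_mx Num.conj U); split; first exact: conj_unitary.
rewrite !trmx_mul tr_diag_mx adjmxE mulmxA; congr (_ *m _ *m _).
  by rewrite /adj trmxK.
by apply/matrixP => i j; rewrite adjmxE adjE !mxE conjCK.
Qed.

Lemma eigdec_trace_pow n (A : 'M[C]_n) d j : eigdec A d ->
  \tr (iter j (mulmx A) A) = (\sum_k d k ^+ j.+1)%:C.
Proof.
case=> U [hU ->]; have hU' := unitary_comm hU.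
set B := U *m _ *m _.
have -> : iter j (mulmx B) B = U *m rdiag (fun k => d k ^+ j.+1) *m adj U.
  elim: j => [|j IH].
    by rewrite /B; congr (_ *m diag_mx _ *m _); apply/rowP => k; rewrite !mxE expr1.
  rewrite /= IH /B adjmxE !mulmxA -(mulmxA _ (adj U) U) hU' mulmx1; congr (_ *m _).
  rewrite -mulmxA mulmx_diag; congr (_ *m diag_mx _).
  by apply/rowP => k; rewrite !mxE -RtoCM -exprS.
rewrite mxtrace_mulC mulmxA hU' mul1mx mxtrace_diag RtoC_sum.
by apply: eq_bigr => k _; rewrite mxE.
Qed.

Lemma interpolation (s : seq R) (h : R -> R) :
  exists f : {poly R}, forall x, x \in s -> f.[x] = h x.
Proof.
elim: s => [|x s [f hf]]; first by exists 0.
have [xs|xs] := boolP (x \in s).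
  by exists f => y; rewrite inE => /orP [/eqP ->|]; apply: hf.
pose P := \prod_(y <- s) ('X - y%:P).
have Px : P.[x] != 0 by have := xs; rewrite -root_prod_XsubC.
exists (f + ((h x - f.[x]) / P.[x]) *: P) => y; rewrite inE hornerD hornerZ.
case/orP => [/eqP ->|ys]; first by rewrite divfK // addrC subrK.
have /rootP -> : root P y by rewrite root_prod_XsubC.
by rewrite mulr0 addr0 hf.
Qed.

(* A function vanishing at [0] agrees on both spectra with a polynomial without constant
   term, whose spectral sum is a combination of traces of positive powers. *)
Lemma eq_spectral_sum n m (A : 'M[C]_n) (B : 'M[C]_m) d d' (h : R -> R) :
  eigdec A d -> eigdec B d' ->
  (forall j, \tr (iter j (mulmx A) A) = \tr (iter j (mulmx B) B)) ->
  h 0 = 0 -> \sum_k h (d k) = \sum_k h (d' k).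
Proof.
move=> hA hB htr h0.
have pows j : \sum_k d k ^+ j.+1 = \sum_k d' k ^+ j.+1.
  by apply: (@complexI R); rewrite -(eigdec_trace_pow j hA) htr (eigdec_trace_pow j hB).
have [f hf] := interpolation (0 :: [seq d k | k : 'I_n] ++ [seq d' k | k : 'I_m]) h.
have f0 : f`_0 = 0 by rewrite -horner_coef0 hf ?inE ?eqxx.
have hd k : h (d k) = f.[d k].
  by rewrite hf // inE mem_cat map_f ?mem_enum ?orbT.
have hd' k : h (d' k) = f.[d' k].
  have hk : d' k \in [seq d' k | k : 'I_m] by rewrite map_f ?mem_enum.
  by rewrite hf // inE mem_cat hk !orbT.
have e p (x : 'I_p -> R) : \sum_k f.[x k] = \sum_(i < size f) f`_i * \sum_k x k ^+ i.
  under eq_bigr do rewrite horner_coef; rewrite exchange_big; apply: eq_bigr => i _ /=.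
  by rewrite big_distrr.
under eq_bigr do rewrite hd; under [RHS]eq_bigr do rewrite hd'.
rewrite !e; apply: eq_bigr => -[[|i] hi] _ /=; first by rewrite f0 !mul0r.
by rewrite pows.
Qed.

Definition eta (x : R) : R := - (x * ln x).

Lemma eta0 : eta 0 = 0. Proof. by rewrite /eta mul0r oppr0. Qed.

(** [spec] is an arbitrary choice among diagonalisations; this makes the entropy computable from any
    of them. *)
Lemma vnS_eigdec n (A : 'M[C]_n) d : eigdec A d -> vnS A = \sum_k eta (d k).
Proof.
move=> hA; apply: (eq_spectral_sum (spec_eigdec (eigdec_herm hA)) hA) => //.
exact: eta0.
Qed.

Lemma hermitian_gram m n (M : 'M[C]_(m, n)) : Defs.hermitian (M *m adj M).
Proof. by rewrite /Defs.hermitian adjmxE adjM adjK. Qed.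

(** The Schmidt decomposition in trace form: the two matrices may differ in size, but cyclicity
    equates the traces of their positive powers, and the surplus zero eigenvalues are harmless since
    [eta 0 = 0]. *)
Lemma vnS_gram_tr m n (M : 'M[C]_(m, n)) : vnS (M *m adj M) = vnS (M^T *m adj M^T).
Proof.
have hA := spec_eigdec (hermitian_gram M).
have hB := spec_eigdec (hermitian_gram (adj M)); rewrite adjK in hB.
rewrite gram_tr (vnS_eigdec (eigdec_trmx hB)).
apply: (eq_spectral_sum hA hB) eta0 => j.
pose Y := iter j (mulmx (adj M *m M)) 1%:M.
have -> : iter j (mulmx (M *m adj M)) (M *m adj M) = M *m Y *m adj M.
  rewrite /Y; elim: j {Y} => [|j IH] /=; first by rewrite mulmx1.
  by rewrite IH !mulmxA.
have -> : iter j (mulmx (adj M *m M)) (adj M *m M) = Y *m (adj M *m M).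
  rewrite /Y; elim: j {Y} => [|j IH] /=; first by rewrite mul1mx.
  by rewrite IH !mulmxA.
by rewrite -mulmxA mxtrace_mulC mulmxA.
Qed.

Lemma eigdec_quad n (A : 'M[C]_n) d (U : 'M[C]_n) (y : 'cV[C]_n) :
  U *m adj U = 1%:M -> A = U *m rdiag d *m adj U ->
  (adj (U *m y) *m A *m (U *m y)) 0 0 = (\sum_k d k * sqn (y k 0))%:C.
Proof.
move=> hU ->; have hU' := unitary_comm hU.
rewrite adjM !mulmxA -(mulmxA (adj y)) hU' mulmx1 -(mulmxA _ (adj U)) hU' mulmx1.
rewrite mxE RtoC_sum; apply: eq_bigr => k _.
rewrite mul_mx_diag !mxE RtoCM sqnE; ring.
Qed.

Lemma psd_eigdec_ge0 n (A : 'M[C]_n) d : psd A -> eigdec A d -> forall k, 0 <= d k.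
Proof.
move=> [_ hA] [U [hU e]] k; have := hA (U *m delta_mx k 0).
rewrite adjmxE (eigdec_quad _ hU e) ler0c (bigD1 k) //= mxE !eqxx /=.
rewrite big1 ?addr0; last first.
  by move=> j /negbTE nj; rewrite mxE nj /= /sqn /= expr0n addr0 mulr0.
by rewrite /sqn /= expr1n expr0n addr0 mulr1.
Qed.

Lemma trace_eigdec n (A : 'M[C]_n) d : eigdec A d -> \tr A = (\sum_k d k)%:C.
Proof.
by move=> /(eigdec_trace_pow 0) /= ->; congr (_%:C); apply: eq_bigr => k _; rewrite expr1.
Qed.

Lemma state_eigdec n (A : 'M[C]_n) d : is_state A -> eigdec A d ->
  (forall k, 0 <= d k) /\ \sum_k d k = 1.
Proof.
move=> [hA trA] hd; split; first exact: psd_eigdec_ge0 hA hd.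
by apply: (@complexI R); rewrite -(trace_eigdec hd).
Qed.

Lemma psd_gram m n (M : 'M[C]_(m, n)) : psd (M *m adj M).
Proof.
split; first exact: hermitian_gram.
move=> v; rewrite adjmxE.
have -> : adj v *m (M *m adj M) *m v = (adj v *m M) *m adj (adj v *m M).
  by rewrite adjM adjK !mulmxA.
rewrite mxE sumr_ge0 // => k _; rewrite [adj _ k 0]adjE -normCK; exact: exprn_ge0.
Qed.

Lemma psd_mixture n (I : finType) (c : I -> R) (A : I -> 'M[C]_n) :
  (forall i, 0 <= c i) -> (forall i, psd (A i)) -> psd (\sum_i (c i)%:C *: A i).
Proof.
move=> c0 hA; split.
  rewrite /Defs.hermitian adjmxE adj_sum; apply: eq_bigr => i _.
  by rewrite adjZ conj_RtoC -adjmxE (hA i).1.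
move=> v; rewrite mulmx_sumr mulmx_suml summxE sumr_ge0 // => i _.
by rewrite -scalemxAr -scalemxAl mxE mulr_ge0 ?ler0c // (hA i).2.
Qed.

Lemma state_mixture n (I : finType) (c : I -> R) (A : I -> 'M[C]_n) :
  (forall i, 0 <= c i) -> \sum_i c i = 1 -> (forall i, is_state (A i)) ->
  is_state (\sum_i (c i)%:C *: A i).
Proof.
move=> c0 c1 hA; split; first by apply: psd_mixture => // i; case: (hA i).
rewrite raddf_sum -[RHS]/(1%:C) -c1 RtoC_sum; apply: eq_bigr => i _ /=.
by rewrite mxtraceZ (hA i).2 mulr1.
Qed.

Lemma state_ketbra n (v : 'cV[C]_n) : unit_vector v -> is_state (ketbra v).
Proof.
move=> hv; split; first exact: psd_gram.
by rewrite /ketbra mxtrace_mulC /mxtrace big_ord1.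
Qed.

End Spectrum.

(** * Entropy: additivity, concavity and the Shannon bound *)

Section Entropy.
Variable R : realType.
Local Notation C := R[i].
Local Open Scope complex_scope.

Lemma ln_ratio_le (x y : R) : 0 < x -> 0 < y -> x * (ln y - ln x) <= y - x.
Proof.
move=> x0 y0; rewrite -ln_div ?posrE //.
have h : ln (y / x) <= y / x - 1.
  rewrite -{1}[y / x](subrK 1) addrC; apply: le_ln1Dx.
  by rewrite ltrBrDl subrr divr_gt0.
apply: le_trans (ler_wpM2l (ltW x0) h) _.
by rewrite mulrBr mulr1 mulrCA divff ?gt_eqF // mulr1.
Qed.

Lemma eta_tangent (x y : R) : 0 <= x -> 0 < y -> eta x <= - (x * ln y) - x + y.
Proof.
rewrite le_eqVlt => /orP [/eqP <-|x0] y0; first by rewrite eta0; lra.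
by have := ln_ratio_le x0 y0; rewrite /eta; lra.
Qed.

Lemma eta_jensen (I : finType) (w x : I -> R) :
  (forall i, 0 <= w i) -> \sum_i w i = 1 -> (forall i, 0 <= x i) ->
  \sum_i w i * eta (x i) <= eta (\sum_i w i * x i).
Proof.
move=> w0 w1 x0; set y := \sum_i w i * x i.
have : 0 <= y by apply: sumr_ge0 => i _; rewrite mulr_ge0.
rewrite le_eqVlt => /orP [/eqP y0|y0].
  have z i : w i * x i = 0.
    by apply: (psumr_eq0P _ (esym y0)) => // j _; rewrite mulr_ge0.
  by rewrite -y0 eta0 big1 // => i _; rewrite /eta mulrN mulrA z mul0r oppr0.
apply: (@le_trans _ _ (\sum_i w i * (- (x i * ln y) - x i + y))).
  by apply: ler_sum => i _; rewrite ler_wpM2l // eta_tangent.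
have e c z : \sum_i w i * (- (x i * c) - x i + z) = - (y * c) - y + (\sum_i w i) * z.
  rewrite /y !big_distrl /= -!sumrN -!big_split /=.
  by apply: eq_bigr => i _; ring.
by rewrite e w1 mul1r subrK.
Qed.

Lemma sum_prod_expectation N r (p h : 'I_N -> 'I_r -> R) :
  (forall k, \sum_i p k i = 1) ->
  \sum_(t : {ffun 'I_N -> 'I_r}) (\prod_k p k (t k)) * \sum_j h j (t j) =
  \sum_j \sum_i p j i * h j i.
Proof.
move=> p1; under eq_bigr do rewrite big_distrr /=.
rewrite exchange_big; apply: eq_bigr => j _ /=.
pose F k i := p k i * (if k == j then h j i else 1).
transitivity (\sum_(t : {ffun 'I_N -> 'I_r}) \prod_k F k (t k)).
  apply: eq_bigr => t _; rewrite big_split /=; congr (_ * _).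
  by rewrite (bigD1 j) //= eqxx big1 ?mulr1 // => k /negbTE ->.
rewrite -bigA_distr_bigA (bigD1 j) //= [X in _ * X]big1 ?mulr1.
  by apply: eq_bigr => i _; rewrite /F eqxx.
by move=> k /negbTE kj; rewrite -(p1 k); apply: eq_bigr => i _; rewrite /F kj mulr1.
Qed.

Lemma ln_prod N (x : 'I_N -> R) : (forall k, 0 < x k) ->
  0 < \prod_k x k /\ ln (\prod_k x k) = \sum_k ln (x k).
Proof.
move=> x0; elim/big_rec2: _ => [|k y s _ [s0 e]]; first by rewrite ln1.
by rewrite mulr_gt0 // lnM ?posrE // e.
Qed.

(** If some factor is zero the weight kills both sides, so the value of [ln] at zero does not
    matter. *)
Lemma ln_prod_weight N (x : 'I_N -> R) : (forall k, 0 <= x k) ->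
  (\prod_k x k) * ln (\prod_k x k) = (\prod_k x k) * \sum_k ln (x k).
Proof.
move=> x0; have [h|] := boolP [forall k, 0 < x k]; last first.
  case/forallPn => k; rewrite -leNgt => xk.
  have e : \prod_k x k = 0.
    apply/eqP; rewrite prodf_seq_eq0; apply/hasP.
    by exists k; rewrite ?mem_index_enum //= eq_le xk x0.
  by rewrite e !mul0r.
by rewrite (ln_prod (fun k => forallP h k)).2.
Qed.

Lemma eigdec_tpow N n (X : 'I_N -> 'M[C]_n) (d : 'I_N -> 'I_n -> R) :
  (forall k, eigdec (X k) (d k)) ->
  eigdec (tpow X) (fun b => \prod_k d k (digits b k)).
Proof.
move=> /choice [U hU]; exists (tpow U); rewrite adjmxE tpow_adj tpowM; split.
  rewrite -tpow1; apply/matrixP => a b; rewrite !mxE; apply: eq_bigr => k _.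
  by rewrite -(hU k).1.
have -> : diag_mx (\row_b (\prod_k d k (digits b k))%:C) = tpow (fun k => rdiag (d k)).
  by rewrite tpow_diag; congr diag_mx; apply/rowP => b; rewrite !mxE RtoC_prod.
rewrite !tpowM; apply/matrixP => a b; rewrite !mxE; apply: eq_bigr => k _.
by rewrite {1}(hU k).2.
Qed.

Lemma vnS_tpow N n (X : 'I_N -> 'M[C]_n) : (forall k, is_state (X k)) ->
  vnS (tpow X) = \sum_k vnS (X k).
Proof.
move=> hX; have hd k : eigdec (X k) (spec (X k)) by apply: spec_eigdec; case: (hX k) => -[].
have d0 k i : 0 <= spec (X k) i by have [] := state_eigdec (hX k) (hd k).
have d1 k : \sum_i spec (X k) i = 1 by have [] := state_eigdec (hX k) (hd k).
rewrite (vnS_eigdec (eigdec_tpow hd)).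
rewrite (sum_digits (fun t : {ffun 'I_N -> 'I_n} => eta (\prod_k spec (X k) (t k)))).
transitivity (\sum_(t : {ffun 'I_N -> 'I_n}) (\prod_k spec (X k) (t k)) *
   \sum_k - ln (spec (X k) (t k))).
  apply: eq_bigr => t _; rewrite /eta ln_prod_weight; last by move=> k; exact: d0.
  by rewrite sumrN mulrN.
rewrite (sum_prod_expectation (fun k i => - ln (spec (X k) i)) d1).
by apply: eq_bigr => k _; apply: eq_bigr => i _; rewrite mulrN.
Qed.

Lemma unitary_row_sqn n (O : 'M[C]_n) j : O *m adj O = 1%:M -> \sum_l sqn (O j l) = 1.
Proof.
move=> /matrixP/(_ j j); rewrite !mxE eqxx => h; apply: (@complexI R).
by rewrite RtoC_sum -[RHS]h; apply: eq_bigr => l _; rewrite sqnE adjE.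
Qed.

Lemma unitary_col_sqn n (O : 'M[C]_n) l : O *m adj O = 1%:M -> \sum_j sqn (O j l) = 1.
Proof.
move=> /unitary_comm /matrixP/(_ l l); rewrite !mxE eqxx => h; apply: (@complexI R).
by rewrite RtoC_sum -[RHS]h; apply: eq_bigr => j _; rewrite sqnE adjE mulrC.
Qed.

(** In the eigenbasis of the mixture each of its eigenvalues is an average of the eigenvalues of the
    [rho i], with weights from the squared moduli of a unitary. Row sums equal to one permit Jensen,
    and column sums equal to one restore the entropies. *)
Theorem vnS_concave n (I : finType) (p : I -> R) (rho : I -> 'M[C]_n) :
  (forall i, 0 <= p i) -> \sum_i p i = 1 -> (forall i, is_state (rho i)) ->
  \sum_i p i * vnS (rho i) <= vnS (\sum_i (p i)%:C *: rho i).
Proof.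
move=> p0 p1 hrho; set sigma := \sum_i _ *: _.
have hs : is_state sigma by apply: state_mixture.
have [V [hV eV]] : eigdec sigma (spec sigma) by apply: spec_eigdec; case: hs => -[].
have hd i : eigdec (rho i) (spec (rho i)) by apply: spec_eigdec; case: (hrho i) => -[].
have /choice [W hW] := hd.
have d0 i l : 0 <= spec (rho i) l by have [] := state_eigdec (hrho i) (hd i).
pose O i := adj V *m W i.
have hO i : O i *m adj (O i) = 1%:M.
  rewrite /O adjM adjK mulmxA -(mulmxA _ (W i)) (hW i).1 mulmx1.
  exact: unitary_comm hV.
have mu j : spec sigma j =
    \sum_(il : I * 'I_n) (p il.1 * sqn (O il.1 j il.2)) * spec (rho il.1) il.2.
  apply: (@complexI R).
  have -> : (spec sigma j)%:C = (adj V *m sigma *m V) j j.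
    rewrite [in RHS]eV adjmxE !mulmxA -(mulmxA _ (adj V) V) (unitary_comm hV) mulmx1 mul1mx.
    by rewrite !mxE eqxx.
  rewrite mulmx_sumr mulmx_suml summxE RtoC_sum.
  rewrite -(pair_bigA _ (fun i l => ((p i * sqn (O i j l)) * spec (rho i) l)%:C)) /=.
  apply: eq_bigr => i _; rewrite -scalemxAr -scalemxAl mxE.
  have -> : adj V *m rho i *m V = O i *m rdiag (spec (rho i)) *m adj (O i).
    by rewrite {1}(hW i).2 /O adjM adjK !mulmxA.
  rewrite mxE big_distrr /=; apply: eq_bigr => l _.
  by rewrite mul_mx_diag !mxE !RtoCM sqnE; ring.
rewrite [leRHS]/vnS.
apply: (@le_trans _ _ (\sum_j \sum_(il : I * 'I_n)
   (p il.1 * sqn (O il.1 j il.2)) * eta (spec (rho il.1) il.2))); last first.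
  apply: ler_sum => j _; rewrite -/(eta _) mu; apply: eta_jensen => //.
    by move=> il; rewrite mulr_ge0 ?sqn_ge0.
  rewrite -(pair_bigA _ (fun i l => p i * sqn (O i j l))) /= -p1.
  by apply: eq_bigr => i _; rewrite -big_distrr /= unitary_row_sqn // mulr1.
rewrite exchange_big /=.
rewrite -(pair_bigA _ (fun i l => \sum_j (p i * sqn (O i j l)) * eta (spec (rho i) l))) /=.
apply: ler_sum => i _; rewrite big_distrr /=; apply: ler_sum => l _.
by rewrite -big_distrl -big_distrr /= unitary_col_sqn // mulr1.
Qed.

(** * A Klein-type inequality for amplitude tables with orthogonal rows *)

Section CrossEntropy.
Variables (X Y : finType) (f : X -> Y -> C) (beta : X -> R) (q : Y -> R).
Hypothesis gram : forall x x', \sum_y f x y * (f x' y)^*%R = (beta x)%:C * (x == x')%:R.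
Hypothesis beta_sum : \sum_x beta x = 1.
Hypotheses (q_ge0 : forall y, 0 <= q y) (q_sum : \sum_y q y = 1).
Hypothesis supp : forall x y, f x y != 0 -> 0 < q y.

Lemma gram_diag x : beta x = \sum_y sqn (f x y).
Proof.
apply: (@complexI R); rewrite RtoC_sum; have := gram x x; rewrite eqxx mulr1 => <-.
by apply: eq_bigr => y _; rewrite sqnE.
Qed.

(** [v] is the projection of the unit vector at [y] on the span of the rows. Its [y] coordinate and
    its squared norm are both [s], so [s ^+ 2 <= s]. Rows with [beta x = 0] drop out because
    division by zero yields zero. *)
Lemma gram_bessel y : \sum_x sqn (f x y) / beta x <= 1.
Proof.
set s := \sum_x _.
have b0 x : 0 <= beta x by rewrite gram_diag sumr_ge0 // => z _; rewrite sqn_ge0.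
have s0 : 0 <= s by apply: sumr_ge0 => x _; rewrite divr_ge0 ?sqn_ge0.
pose v z := \sum_x ((f x y)^*%R / (beta x)%:C) * f x z.
have vy : v y = s%:C.
  rewrite RtoC_sum; apply: eq_bigr => x _.
  by rewrite RtoCM sqnE (fmorphV (real_complex R)) mulrC mulrA.
have vv : \sum_z sqn (v z) = s.
  apply: (@complexI R); rewrite RtoC_sum.
  transitivity (\sum_x \sum_x' ((f x y)^*%R / (beta x)%:C) *
     ((f x' y) / (beta x')%:C) * ((beta x)%:C * (x == x')%:R)).
    transitivity (\sum_z \sum_x \sum_x' ((f x y)^*%R / (beta x)%:C) *
       ((f x' y) / (beta x')%:C) * (f x z * (f x' z)^*%R)).
      apply: eq_bigr => z _; rewrite sqnE /v rmorph_sum big_distrl; apply: eq_bigr => x _ /=.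
      rewrite big_distrr; apply: eq_bigr => x' _ /=.
      by rewrite !rmorphM /= conjCK fmorphV /= conj_RtoC; ring.
    rewrite exchange_big; apply: eq_bigr => x _ /=.
    rewrite exchange_big; apply: eq_bigr => x' _ /=.
    by rewrite -big_distrr /= gram.
  rewrite RtoC_sum; apply: eq_bigr => x _; under eq_bigr do rewrite mulrA.
  rewrite sum_delta RtoCM sqnE (fmorphV (real_complex R)) /=.
  have [->|nz] := eqVneq (beta x) 0; first by rewrite invr0 !mulr0.
  by field; rewrite fmorph_eq0.
have : s ^+ 2 <= s.
  rewrite -{2}vv (bigD1 y) //= vy.
  have -> : sqn s%:C = s ^+ 2 by rewrite /sqn /= expr0n addr0.
  by rewrite lerDl sumr_ge0 // => z _; rewrite sqn_ge0.
by rewrite leNgt => /negP h; rewrite leNgt; apply/negP => s1; apply: h; nra.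
Qed.

(** The bound [ln t <= t - 1] at [t = q y / beta x], weighted by [sqn (f x y)]; summing over [x]
    leaves at most [q y] by [gram_bessel]. It serves the Shannon bound with [q = p] and the
    Araki-Lieb inequality with a product distribution. *)
Lemma cross_entropy : \sum_x eta (beta x) <= - \sum_x \sum_y sqn (f x y) * ln (q y).
Proof.
have key x y : sqn (f x y) * (ln (q y) - ln (beta x)) <=
    q y * (sqn (f x y) / beta x) - sqn (f x y).
  have [->|nz] := eqVneq (f x y) 0.
    by rewrite /sqn /= expr0n addr0 !(mul0r, mulr0) subr0.
  have w0 : 0 < sqn (f x y).
    by rewrite lt_def sqn_ge0 andbT; apply/eqP => /sqn_eq0 e; rewrite e eqxx in nz.
  have b0 : 0 < beta x.
    rewrite gram_diag (bigD1 y) //= ltr_pwDl // sumr_ge0 // => z _; exact: sqn_ge0.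
  have h := ln_ratio_le b0 (supp nz).
  have {}h : ln (q y) - ln (beta x) <= q y / beta x - 1.
    rewrite -(ler_pM2l b0); apply: (le_trans h).
    by rewrite mulrBr mulr1 mulrCA divff ?gt_eqF // mulr1.
  apply: le_trans (ler_wpM2l (ltW w0) h) _.
  by rewrite le_eqVlt; apply/orP; left; apply/eqP; field; rewrite gt_eqF.
have e : \sum_x eta (beta x) = - \sum_x \sum_y sqn (f x y) * ln (beta x).
  by rewrite -sumrN; apply: eq_bigr => x _; rewrite /eta -big_distrl -gram_diag.
rewrite e -subr_ge0 opprK addrC -opprB oppr_ge0 -sumrB.
apply: (@le_trans _ _ (\sum_x \sum_y (q y * (sqn (f x y) / beta x) - sqn (f x y)))).
  by apply: ler_sum => x _; rewrite -sumrB; apply: ler_sum => y _; rewrite -mulrBr.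
under eq_bigr do rewrite sumrB -gram_diag; rewrite sumrB beta_sum exchange_big /=.
rewrite subr_le0 -q_sum; apply: ler_sum => y _; rewrite -big_distrr /=.
by rewrite ler_piMr // gram_bessel.
Qed.

End CrossEntropy.

(** The table [f] holds the coordinates of [sqrt (p i) psi i] in an eigenbasis of [rho]. Its rows
    are orthogonal with squared norms the eigenvalues, and the squared norm of column [i] is
    [p i]. *)
Theorem vnS_le_shannon d n (p : 'I_n -> R) (psi : 'I_n -> 'cV[C]_d) :
  (forall i, 0 < p i) -> \sum_i p i = 1 -> (forall i, unit_vector (psi i)) ->
  vnS (\sum_i (p i)%:C *: ketbra (psi i)) <= shannon p.
Proof.
move=> p0 p1 hpsi; set rho := \sum_i _.
have hs : is_state rho.
  by apply: state_mixture => // i; [exact: ltW|exact: state_ketbra].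
have hd : eigdec rho (spec rho) by apply: spec_eigdec; case: hs => -[].
have [U [hU eU]] := hd; have hU' := unitary_comm hU.
pose c i := adj U *m psi i.
pose f k i : C := (Num.sqrt (p i))%:C * c i k 0.
have sq i : (Num.sqrt (p i))%:C * (Num.sqrt (p i))%:C = (p i)%:C.
  by rewrite -RtoCM -expr2 sqr_sqrtr // ltW.
have gr k l : \sum_i f k i * (f l i)^*%R = (spec rho k)%:C * (k == l)%:R.
  have -> : (spec rho k)%:C * (k == l)%:R = (adj U *m rho *m U) k l.
    rewrite [in RHS]eU adjmxE !mulmxA -(mulmxA _ (adj U) U) hU' mulmx1 mul1mx.
    by rewrite !mxE mulr_natr.
  rewrite mulmx_sumr mulmx_suml summxE; apply: eq_bigr => i _.
  rewrite -scalemxAr -scalemxAl mxE.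
  have -> : adj U *m ketbra (psi i) *m U = ketbra (c i).
    by rewrite /c -conj_ketbra adjmxE adjK.
  by rewrite ketbraE /f rmorphM /= conj_RtoC -sq; ring.
have [_ b1] := state_eigdec hs hd.
have := cross_entropy gr b1 (fun i => ltW (p0 i)) p1 (fun _ i _ => p0 i).
rewrite -/(vnS rho) => /le_trans; apply.
rewrite /shannon lerN2 exchange_big /= le_eqVlt; apply/orP; left; apply/eqP.
apply: eq_bigr => i _; rewrite -big_distrl /=; congr (_ * _).
apply: (@complexI R); rewrite RtoC_sum.
transitivity ((p i)%:C * (adj (c i) *m c i) 0 0).
  have -> : adj (c i) *m c i = adjmx (psi i) *m psi i.
    by rewrite /c adjM adjK !mulmxA -(mulmxA _ U) hU mulmx1.
  by rewrite hpsi mulr1.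
rewrite mxE big_distrr /=; apply: eq_bigr => k _.
by rewrite sqnE /f rmorphM /= conj_RtoC adjE -sq; ring.
Qed.

End Entropy.

(** * Reduced states and the Araki-Lieb inequality *)

Section Marginals.
Variable R : realType.
Local Notation C := R[i].
Local Open Scope complex_scope.

(** The first party's marginal of the mixture of the vectors [vec (M k)]; feeding in the transposes
    gives the second party's. *)
Definition reduced (I : finType) m n (lam : I -> R) (M : I -> 'M[C]_(m, n)) : 'M[C]_m :=
  \sum_k (lam k)%:C *: (M k *m adj (M k)).

Lemma state_reduced (I : finType) m n (lam : I -> R) (M : I -> 'M[C]_(m, n)) :
  (forall k, 0 <= lam k) -> \sum_k lam k = 1 ->
  (forall k, \tr (M k *m adj (M k)) = 1) -> is_state (reduced lam M).
Proof.
by move=> l0 l1 M1; apply: state_mixture => // k; split; [exact: psd_gram|exact: M1].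
Qed.

Lemma trace_gram_tr m n (M : 'M[C]_(m, n)) : \tr (M^T *m adj M^T) = \tr (M *m adj M).
Proof. by rewrite gram_tr mxtrace_tr mxtrace_mulC. Qed.

(* The purifying system has entropy [\sum_k eta (lam k)]; this is subadditivity for
   the first party and the purifying system, whose joint entropy is that of the second. *)
Theorem araki_lieb (I : finType) m n (lam : I -> R) (M : I -> 'M[C]_(m, n)) :
  (forall k, 0 <= lam k) -> \sum_k lam k = 1 ->
  (forall k, \tr (M k *m adj (M k)) = 1) ->
  vnS (reduced lam (fun k => (M k)^T)) <= vnS (reduced lam M) + \sum_k eta (lam k).
Proof.
move=> l0 l1 M1; set rB := reduced _ (fun k => _); set rA := reduced lam M.
have sA : is_state rA by apply: state_reduced.
have sB : is_state rB by apply: state_reduced => // k; rewrite trace_gram_tr.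
have dA : eigdec rA (spec rA) by apply: spec_eigdec; case: sA => -[].
have dB : eigdec rB (spec rB) by apply: spec_eigdec; case: sB => -[].
have [a0 a1] := state_eigdec sA dA; have [b0 b1] := state_eigdec sB dB.
have [V [hV eV]] := dA; have [W [hW eW]] := dB.
have hV' := unitary_comm hV; have hW' := unitary_comm hW.
pose M' k := adj V *m M k *m map_mx Num.conj W.
have cW := conj_unitary hW; have cV := conj_unitary hV.
have M'A k : M' k *m adj (M' k) = adj V *m (M k *m adj (M k)) *m V.
  by rewrite /M' !adjM adjK !mulmxA -(mulmxA _ _ (adj (map_mx _ W))) cW mulmx1.
have M'B k : (M' k)^T *m adj (M' k)^T = adj W *m ((M k)^T *m adj (M k)^T) *m W.
  have -> : (M' k)^T = adj W *m (M k)^T *m map_mx Num.conj V.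
    by rewrite /M' !trmx_mul mulmxA; congr (_ *m _ *m _); rewrite /adj trmxK.
  by rewrite !adjM adjK !mulmxA -(mulmxA _ _ (adj (map_mx _ V))) cV mulmx1.
move: M' M'A M'B => M' M'A M'B.
have diagA : \sum_k (lam k)%:C *: (M' k *m adj (M' k)) = rdiag (spec rA).
  transitivity (adj V *m rA *m V).
    rewrite mulmx_sumr mulmx_suml; apply: eq_bigr => k _.
    by rewrite M'A -scalemxAr -scalemxAl.
  by rewrite [in LHS]eV adjmxE !mulmxA -(mulmxA _ (adj V) V) hV' mulmx1 mul1mx.
have diagB : \sum_k (lam k)%:C *: ((M' k)^T *m adj (M' k)^T) = rdiag (spec rB).
  transitivity (adj W *m rB *m W).
    rewrite mulmx_sumr mulmx_suml; apply: eq_bigr => k _.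
    by rewrite M'B -scalemxAr -scalemxAl.
  by rewrite [in LHS]eW adjmxE !mulmxA -(mulmxA _ (adj W) W) hW' mulmx1 mul1mx.
have sq k : (Num.sqrt (lam k))%:C * (Num.sqrt (lam k))%:C = (lam k)%:C.
  by rewrite -RtoCM -expr2 sqr_sqrtr.
(* Amplitudes of the purification, both parties being in their eigenbases: the row is the second
   party, the column is the purifying index together with the first party. *)
pose f b (ka : I * 'I_m) : C := (Num.sqrt (lam ka.1))%:C * M' ka.1 ka.2 b.
have fE b ka : sqn (f b ka) = lam ka.1 * sqn (M' ka.1 ka.2 b).
  apply: (@complexI R); rewrite RtoCM !sqnE /f rmorphM /= conj_RtoC -sq; ring.
have gr b b' : \sum_ka f b ka * (f b' ka)^*%R = (spec rB b)%:C * (b == b')%:R.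
  have -> : (spec rB b)%:C * (b == b')%:R = rdiag (spec rB) b b' by rewrite !mxE mulr_natr.
  rewrite -diagB summxE -(pair_bigA _ (fun k a => f b (k, a) * (f b' (k, a))^*%R)) /=.
  apply: eq_bigr => k _; rewrite !mxE big_distrr /=; apply: eq_bigr => a _.
  by rewrite adjE !mxE /f rmorphM /= conj_RtoC -sq; ring.
have rowA a : \sum_k lam k * \sum_b sqn (M' k a b) = spec rA a.
  apply: (@complexI R); have -> : (spec rA a)%:C = rdiag (spec rA) a a by rewrite !mxE eqxx.
  rewrite -diagA summxE RtoC_sum; apply: eq_bigr => k _; rewrite mxE RtoCM RtoC_sum mxE.
  by congr (_ * _); apply: eq_bigr => b _; rewrite sqnE adjE.
have rowK k : \sum_a \sum_b sqn (M' k a b) = 1.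
  apply: (@complexI R); rewrite RtoC_sum -[1%:C](M1 k).
  transitivity (\tr (M' k *m adj (M' k))).
    apply: eq_bigr => a _; rewrite mxE RtoC_sum; apply: eq_bigr => b _.
    by rewrite sqnE adjE.
  by rewrite M'A mxtrace_mulC mulmxA hV mul1mx.
have q0 (ka : I * 'I_m) : 0 <= lam ka.1 * spec rA ka.2 by rewrite mulr_ge0.
have q1 : \sum_(ka : I * 'I_m) lam ka.1 * spec rA ka.2 = 1.
  rewrite -(pair_bigA _ (fun k a => lam k * spec rA a)) /= -l1.
  by apply: eq_bigr => k _; rewrite -big_distrr /= a1 mulr1.
(* A nonzero amplitude forces both marginal weights to be positive. This gives the support condition
   and allows the logarithm of the product to be split. *)
have sp b ka : f b ka != 0 -> 0 < lam ka.1 /\ 0 < spec rA ka.2.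
  move=> nz; have w0 : 0 < lam ka.1 * sqn (M' ka.1 ka.2 b).
    rewrite -fE lt_def sqn_ge0 andbT; apply/eqP => /sqn_eq0 e.
    by rewrite e eqxx in nz.
  have lp : 0 < lam ka.1.
    by rewrite lt_def l0 andbT; apply/eqP => e; rewrite e mul0r ltxx in w0.
  split=> //; rewrite -rowA (bigD1 ka.1) //= ltr_pwDl //.
    rewrite mulr_gt0 // (bigD1 b) //= ltr_pwDl //; first by rewrite -(pmulr_rgt0 _ lp).
    by apply: sumr_ge0 => *; exact: sqn_ge0.
  by apply: sumr_ge0 => *; rewrite mulr_ge0 // sumr_ge0 // => *; exact: sqn_ge0.
have := cross_entropy gr b1 q0 q1 (fun b ka h => mulr_gt0 (sp b ka h).1 (sp b ka h).2).
rewrite -/(vnS rB) => /le_trans; apply.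
rewrite le_eqVlt; apply/orP; left; apply/eqP.
have -> : \sum_b \sum_ka sqn (f b ka) * ln (lam ka.1 * spec rA ka.2) =
  \sum_k \sum_a \sum_b (lam k * sqn (M' k a b) * ln (lam k)
                           + lam k * sqn (M' k a b) * ln (spec rA a)).
  rewrite exchange_big /=.
  rewrite -(pair_bigA _ (fun k a => \sum_b sqn (f b (k, a)) * ln (lam k * spec rA a))) /=.
  apply: eq_bigr => k _; apply: eq_bigr => a _; apply: eq_bigr => b _.
  rewrite -mulrDr fE /=.
  have [e|nz] := eqVneq (f b (k, a)) 0.
    by have := fE b (k, a); rewrite e /sqn /= expr0n addr0 => <-; rewrite !mul0r.
  by have [/= h1 h2] := sp b (k, a) nz; rewrite lnM ?posrE.
under eq_bigr do under eq_bigr do rewrite big_split /=.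
under eq_bigr do rewrite big_split /=.
rewrite big_split /= opprD addrC; congr (_ + _).
  rewrite exchange_big /= -sumrN; apply: eq_bigr => a _; rewrite -rowA big_distrl /=.
  congr (- _); apply: eq_bigr => k _; rewrite big_distrr big_distrl //.
rewrite -sumrN; apply: eq_bigr => k _; rewrite /eta; congr (- _).
rewrite -[X in X * _]mulr1 -(rowK k) big_distrr big_distrl /=; apply: eq_bigr => a _.
by rewrite big_distrr big_distrl.
Qed.

End Marginals.

Section TraceNorm.
Variable R : realType.
Local Notation C := R[i].
Local Open Scope complex_scope.

(** The difference has trace zero and at most one negative eigenvalue, so its trace norm is twice
    the modulus of that eigenvalue. The latter is at most the Hilbert-Schmidt norm, whose square is
    [\tr (rho *m rho) - 2 * F + 1 <= 2 * (1 - F)]. *)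
Lemma trnorm_pure_le n (rho : 'M[C]_n) (phi : 'cV[C]_n) (F : R) :
  is_state rho -> unit_vector phi -> (adjmx phi *m rho *m phi) 0 0 = F%:C ->
  trnorm (rho - ketbra phi) <= 2 * Num.sqrt (2 * (1 - F)).
Proof.
move=> hrho hphi hF; have hk := state_ketbra hphi; set D := rho - ketbra phi.
have hD : Defs.hermitian D.
  by rewrite /Defs.hermitian adjmxE adjB -!adjmxE hrho.1.1 hk.1.1.
have dD := spec_eigdec hD; rewrite /trnorm; move: (spec D) dD => d dD.
have [U [hU eU]] := dD; have hU' := unitary_comm hU.
pose c := adj U *m phi.
have quad (y : 'cV[C]_n) : (adj y *m c) 0 0 = 0 -> 0 <= \sum_k d k * sqn (y k 0).
  move=> yc; rewrite -ler0c -(eigdec_quad y hU eU).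
  have -> : adj (U *m y) *m D *m (U *m y) =
      adj (U *m y) *m rho *m (U *m y) - (adj y *m c) *m (adj phi *m (U *m y)).
    by rewrite /D mulmxBr mulmxBl /ketbra /c adjM adjmxE !mulmxA.
  have -> : adj y *m c = 0 by apply/matrixP => i j; rewrite !ord1 yc mxE.
  by rewrite mul0mx subr0; exact: hrho.1.2.
(* Two negative eigenvectors would span a vector orthogonal to [phi]. *)
have one_neg k l : k != l -> d k < 0 -> d l < 0 -> False.
  move=> nkl dk dl.
  have nlk : (l == k) = false by rewrite eq_sym (negbTE nkl).
  pose y : 'cV[C]_n :=
    \col_j if j == k then (c l 0)^*%R else if j == l then - (c k 0)^*%R else 0.
  have hy (G : 'I_n -> C -> R) : (forall j, G j 0 = 0) ->
      \sum_j G j (y j 0) = G k ((c l 0)^*%R) + G l (- (c k 0)^*%R).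
    move=> G0; rewrite (bigD1 k) //= (bigD1 l) /=; last by rewrite nlk.
    rewrite big1 ?addr0; first by rewrite !mxE eqxx nlk eqxx.
    by move=> j /andP [/negbTE jk /negbTE jl]; rewrite mxE jk jl.
  have yc : (adj y *m c) 0 0 = 0.
    rewrite mxE (bigD1 k) //= (bigD1 l) /=; last by rewrite nlk.
    rewrite big1 ?addr0.
      by rewrite !adjE !mxE eqxx nlk eqxx rmorphN /= !conjCK; ring.
    by move=> j /andP [/negbTE jk /negbTE jl]; rewrite adjE [y j 0]mxE jk jl conjC0 mul0r.
  have := quad y yc; rewrite (hy (fun j z => d j * sqn z)); last first.
    by move=> j; rewrite /sqn /= expr0n addr0 mulr0.
  have sqnJ (z : C) : sqn (z^*%R) = sqn z by apply: (@complexI R); rewrite !sqnE conjCK mulrC.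
  have sqnN (z : C) : sqn (- z) = sqn z by apply: (@complexI R); rewrite !sqnE rmorphN mulrNN.
  rewrite sqnN !sqnJ => h.
  have cl := sqn_ge0 (c l 0); have ck := sqn_ge0 (c k 0).
  (* [h] is a nonnegative sum of two nonpositive terms, so [c k 0] vanishes. Then the [k]-th
     eigenvector alone is orthogonal to [phi], which contradicts [d k < 0]. *)
  have ck0 : sqn (c k 0) = 0 by nra.
  have := quad (delta_mx k 0); rewrite mxE (bigD1 k) //= big1 ?addr0; last first.
    by move=> j /negbTE jk; rewrite adjE mxE jk /= conjC0 mul0r.
  rewrite (sqn_eq0 ck0) mulr0 => /(_ erefl).
  rewrite (bigD1 k) //= big1 ?addr0; last first.
    by move=> j /negbTE jk; rewrite mxE jk /= /sqn /= expr0n addr0 mulr0.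
  by rewrite mxE !eqxx /sqn /= expr1n expr0n addr0 mulr1 leNgt dk.
have d_sum : \sum_k d k = 0.
  apply: (@complexI R); rewrite -(trace_eigdec dD) /D mxtraceB hrho.2 hk.2 subrr //.
have rho2 : exists2 r : R, \tr (rho *m rho) = r%:C & r <= 1.
  have dr : eigdec rho (spec rho) by apply: spec_eigdec; case: hrho => -[].
  have [r0 r1] := state_eigdec hrho dr.
  exists (\sum_k spec rho k ^+ 2); first exact: (eigdec_trace_pow 1 dr).
  rewrite -r1; apply: ler_sum => k _; rewrite expr2 ler_piMr //.
  by rewrite -r1 (bigD1 k) //= lerDl sumr_ge0.
have d2 : \sum_k d k ^+ 2 <= 2 * (1 - F).
  have [r er r1] := rho2.
  have -> : \sum_k d k ^+ 2 = r - 2 * F + 1; last by lra.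
  apply: (@complexI R); rewrite -(eigdec_trace_pow 1 dD) /= /D mulmxBl !mulmxBr !mxtraceB er.
  have t1 : \tr (rho *m ketbra phi) = F%:C.
    by rewrite /ketbra mulmxA mxtrace_mulC mulmxA /mxtrace big_ord1.
  have t2 : \tr (ketbra phi *m ketbra phi) = 1.
    rewrite /ketbra mulmxA -(mulmxA phi) mxtrace_mulC.
    have -> : adjmx phi *m phi = 1%:M by apply/matrixP => i j; rewrite !ord1 hphi mxE eqxx.
    by rewrite mulmx1 /mxtrace big_ord1.
  rewrite [\tr (ketbra phi *m rho)]mxtrace_mulC t1 t2.
  have -> : r - 2 * F + 1 = r - F - (F - 1) by ring.
  by rewrite !(rmorphB (real_complex R)).
have [/forallP dge|] := boolP [forall k, 0 <= d k].
  under eq_bigr do rewrite ger0_norm //.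
  by rewrite d_sum mulr_ge0 ?sqrtr_ge0.
case/forallPn => k; rewrite -ltNge => dk.
have -> : \sum_j `|d j| = - 2 * d k.
  rewrite (bigD1 k) //= ltr0_norm //.
  have -> : \sum_(j | j != k) `|d j| = \sum_(j | j != k) d j.
    apply: eq_bigr => j jk; rewrite ger0_norm // leNgt; apply/negP => dj.
    by apply: (one_neg j k).
  by move: d_sum; rewrite (bigD1 k) //= => h; lra.
rewrite mulNr -mulrN ler_pM2l //.
apply: le_trans (_ : Num.sqrt (d k ^+ 2) <= _).
  by rewrite sqrtr_sqr ltr0_norm.
rewrite ler_wsqrtr //; apply: le_trans d2; rewrite (bigD1 k) //= lerDl sumr_ge0 // => j _.
exact: sqr_ge0.
Qed.

End TraceNorm.

(** * Exponential tail bound for sums of independent letters *)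

Section Chernoff.
Variable R : realType.

(** [expR x <= 1 / (1 - x)], and [(1 + x + 2 x^2) (1 - x) = 1 + x^2 (1 - 2 x)], which is at least
    one on this range. *)
Lemma expR_le_quadratic (x : R) : x <= 1/2 -> expR x <= 1 + x + 2 * x ^+ 2.
Proof.
move=> x2; have h : expR (- x) >= 1 - x by exact: expR_ge1Dx.
have x1 : 0 < 1 - x by lra.
have : expR x <= (1 - x)^-1 by rewrite -[expR x]invrK -expRN lef_pV2 ?posrE ?expR_gt0.
move=> /le_trans; apply; rewrite -[leLHS]mul1r ler_pdivrMr //.
have : 0 <= x ^+ 2 * (1 - 2 * x) by rewrite mulr_ge0 ?sqr_ge0 //; lra.
by move=> h2; nra.
Qed.

(** The exponential Markov inequality: [theta] is the moment generating function at [s] of [g],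
    which has mean [- delta]. Any [f] is allowed because the alphabet is finite. *)
Lemma chernoff r (p f : 'I_r -> R) (delta : R) :
  (forall i, 0 <= p i) -> \sum_i p i = 1 -> 0 < delta ->
  exists theta : R, [/\ 0 <= theta, theta < 1 & forall N : nat,
    \sum_(t : {ffun 'I_N -> 'I_r} |
        N%:R * (\sum_i p i * f i + delta) <= \sum_k f (t k)) \prod_k p (t k)
    <= theta ^+ N].
Proof.
move=> p0 p1 d0; set m := \sum_i p i * f i; pose g i := f i - (m + delta).
pose c := 1 + \sum_i `|g i|.
have c1 : 1 <= c by rewrite lerDl sumr_ge0.
have c0 : 0 < c by lra.
have gc i : `|g i| <= c.
  rewrite /c (bigD1 i) //= addrCA lerDl addr_ge0 ?ler01 // sumr_ge0 //.
(* The factor [1 + delta] gives [s * c ^+ 2 <= 1/4], so the quadratic bound on [expR] applies. It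
   also gives [2 * s * c ^+ 2 < delta], so the linear term [- s * delta] beats the quadratic one. *)
pose s := delta / (4 * c ^+ 2 * (1 + delta)).
have den : 0 < 4 * c ^+ 2 * (1 + delta).
  by rewrite !mulr_gt0 ?exprn_gt0 //; lra.
have s0 : 0 < s by rewrite divr_gt0.
have sE : s * (4 * c ^+ 2 * (1 + delta)) = delta by rewrite divfK ?gt_eqF.
pose theta := \sum_i p i * expR (s * g i).
exists theta; split.
- by apply: sumr_ge0 => i _; rewrite mulr_ge0 ?expR_ge0.
- have h : theta <= \sum_i p i * (1 + s * g i + 2 * s ^+ 2 * c ^+ 2).
    apply: ler_sum => i _; rewrite ler_wpM2l //.
    have gi : g i <= c := le_trans (ler_norm _) (gc i).
    have sc : s * c <= 1 / 2.
      have h2 : 0 <= s * c * (c - 1).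
        by apply: mulr_ge0; [exact: ltW (mulr_gt0 s0 c0)|rewrite subr_ge0].
      have z0 : 0 < s * c ^+ 2 := mulr_gt0 s0 (exprn_gt0 2 c0).
      have zE : 4 * (s * c ^+ 2) * (1 + delta) = delta by rewrite -[RHS]sE; ring.
      have : s * c <= s * c ^+ 2 by rewrite expr2 mulrA; lra.
      by move: (s * c ^+ 2) z0 zE => z z0 zE; nra.
    apply: le_trans (expR_le_quadratic _) _; first by nra.
    have : g i ^+ 2 <= c ^+ 2.
      by rewrite -[g i ^+ 2]real_normK ?num_real // ler_sqr ?nnegrE ?(ltW c0).
    move=> h; rewrite lerD2l exprMn mulrA ler_wpM2l // mulr_ge0 ?sqr_ge0 //.
  apply: le_lt_trans h _.
  have -> : \sum_i p i * (1 + s * g i + 2 * s ^+ 2 * c ^+ 2) =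
     (\sum_i p i) * (1 + 2 * s ^+ 2 * c ^+ 2 - s * (m + delta)) + s * m.
    rewrite {2}/m big_distrl big_distrr -big_split /=; apply: eq_bigr => i _.
    by rewrite /g; ring.
  rewrite p1 mul1r.
  have z0 : 0 < s * c ^+ 2 := mulr_gt0 s0 (exprn_gt0 2 c0).
  have zE : 4 * (s * c ^+ 2) * (1 + delta) = delta by rewrite -[RHS]sE; ring.
  have z1 : 2 * (s * c ^+ 2) < delta.
    by move: (s * c ^+ 2) z0 zE => z z0 zE; nra.
  have e2 : 2 * s ^+ 2 * c ^+ 2 = s * (2 * (s * c ^+ 2)) by ring.
  have : s * (2 * (s * c ^+ 2)) < s * delta by rewrite ltr_pM2l.
  by rewrite e2 => z2; lra.
- move=> N.
  have e : theta ^+ N =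
      \sum_(t : {ffun 'I_N -> 'I_r}) \prod_k (p (t k) * expR (s * g (t k))).
    rewrite -(bigA_distr_bigA (fun _ i => p i * expR (s * g i))) /=.
    by rewrite prodr_const card_ord.
  rewrite e [leRHS](bigID (fun t : {ffun 'I_N -> 'I_r} =>
    N%:R * (m + delta) <= \sum_k f (t k))) /=.
  rewrite -[leLHS]addr0 lerD //; last first.
    by apply: sumr_ge0 => t _; apply: prodr_ge0 => k _; rewrite mulr_ge0 ?expR_ge0.
  apply: ler_sum => t ht; rewrite big_split /= ler_peMr ?prodr_ge0 //.
  have -> : \prod_k expR (s * g (t k)) = expR (s * (\sum_k f (t k) - N%:R * (m + delta))).
    by rewrite -expR_sum -big_distrr /= sumrB sumr_const card_ord mulr_natl.
  rewrite -[leLHS]expR0 ler_expR; apply: mulr_ge0; [exact: ltW|by rewrite subr_ge0].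
Qed.

End Chernoff.

(** * Distillation and the hashing bound *)

Section Protocols.
Variable R : realType.
Local Notation C := R[i].
Local Open Scope complex_scope.

Lemma sum_enum_val (V : nmodType) (J : finType) (F : J -> V) :
  \sum_j F j = \sum_(i < #|J|) F (enum_val i).
Proof. by rewrite -(big_enum_val F); apply: eq_bigl => j; rewrite inE. Qed.

Lemma LOCC_A_fin dA dB dA1 dA' dB' (J : finType) (K : J -> 'M[C]_(dA1, dA))
    (Phis : J -> 'M[C]_(dA1 * dB) -> 'M[C]_(dA' * dB')) :
  \sum_j adj (K j) *m K j = 1%:M -> (forall j, LOCC (Phis j)) ->
  LOCC (fun rho => \sum_j Phis j (actA (K j) rho)).
Proof.
move=> hK hP; apply: (@LOCC_A R dA dB dA1 dA' dB' #|J| (fun i => K (enum_val i))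
   (fun i => Phis (enum_val i))) => [|i|rho].
- by rewrite -[RHS]hK [RHS]sum_enum_val.
- exact: hP.
- exact: sum_enum_val.
Qed.

Lemma LOCC_B_fin dA dB dB1 dA' dB' (J : finType) (K : J -> 'M[C]_(dB1, dB))
    (Phis : J -> 'M[C]_(dA * dB1) -> 'M[C]_(dA' * dB')) :
  \sum_j adj (K j) *m K j = 1%:M -> (forall j, LOCC (Phis j)) ->
  LOCC (fun rho => \sum_j Phis j (actB (K j) rho)).
Proof.
move=> hK hP; apply: (@LOCC_B R dA dB dB1 dA' dB' #|J| (fun i => K (enum_val i))
   (fun i => Phis (enum_val i))) => [|i|rho].
- by rewrite -[RHS]hK [RHS]sum_enum_val.
- exact: hP.
- exact: sum_enum_val.
Qed.

Lemma kron_gramA dA dA1 dB m (K : 'I_m -> 'M[C]_(dA1, dA)) :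
  \sum_j adj (K j) *m K j = 1%:M ->
  \sum_j adj (kron (K j) (1%:M : 'M[C]_dB)) *m kron (K j) (1%:M : 'M[C]_dB) = 1%:M.
Proof.
move=> hK; apply/matrixP => x y; have [a [b ->]] := pidxP x; have [a' [b' ->]] := pidxP y.
rewrite summxE mxE eq_pidx.
transitivity ((\sum_j (adj (K j) *m K j)) a a' * (b == b')%:R); last first.
  by rewrite hK mxE -natrM mulnb.
rewrite summxE big_distrl /=; apply: eq_bigr => j _.
rewrite mxE sum_pidx mxE big_distrl /=; apply: eq_bigr => a1 _.
rewrite -[RHS](sum_delta (fun b1 => adj (K j) a a1 * K j a1 a' * (b1 == b')%:R)).
apply: eq_bigr => b1 _; rewrite !adjE !kronE !mxE rmorphM /= conjC_nat [b1 == b]eq_sym; ring.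
Qed.

Lemma kron_gramB dA dB dB1 m (K : 'I_m -> 'M[C]_(dB1, dB)) :
  \sum_j adj (K j) *m K j = 1%:M ->
  \sum_j adj (kron (1%:M : 'M[C]_dA) (K j)) *m kron (1%:M : 'M[C]_dA) (K j) = 1%:M.
Proof.
move=> hK; apply/matrixP => x y; have [a [b ->]] := pidxP x; have [a' [b' ->]] := pidxP y.
rewrite summxE mxE eq_pidx.
transitivity ((a == a')%:R * (\sum_j (adj (K j) *m K j)) b b'); last first.
  by rewrite hK mxE -natrM mulnb.
rewrite summxE big_distrr /=; apply: eq_bigr => j _.
rewrite mxE sum_pidx exchange_big mxE big_distrr /=; apply: eq_bigr => b1 _.
rewrite mulrC -[RHS](sum_delta (fun a1 => adj (K j) b b1 * K j b1 b' * (a1 == a')%:R)).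
apply: eq_bigr => a1 _; rewrite !adjE !kronE !mxE rmorphM /= conjC_nat [a1 == a]eq_sym; ring.
Qed.

Lemma psd_conj m n (A : 'M[C]_(m, n)) (rho : 'M[C]_n) : psd rho -> psd (A *m rho *m adj A).
Proof.
move=> [h1 h2]; split.
  by rewrite /Defs.hermitian adjmxE !adjM adjK mulmxA; congr (_ *m _ *m _).
move=> v; have -> : adjmx v *m (A *m rho *m adj A) *m v =
  adjmx (adj A *m v) *m rho *m (adj A *m v) by rewrite !adjmxE adjM adjK !mulmxA.
exact: h2.
Qed.

Lemma psd_sum n (I : finType) (A : I -> 'M[C]_n) : (forall i, psd (A i)) -> psd (\sum_i A i).
Proof.
move=> hA; have := psd_mixture (fun _ : I => ler01 : 0 <= 1 :> R) hA.
by under eq_bigr do rewrite scale1r.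
Qed.

Lemma instrument_trace m n (J : finType) (A : J -> 'M[C]_(m, n)) (rho : 'M[C]_n) :
  \sum_j adj (A j) *m A j = 1%:M -> \sum_j \tr (A j *m rho *m adj (A j)) = \tr rho.
Proof.
move=> hA; rewrite -[in RHS](mul1mx rho) -hA mulmx_suml raddf_sum; apply: eq_bigr => j _ /=.
by rewrite mxtrace_mulC mulmxA.
Qed.

Lemma LOCC_psd_trace dA dB dA' dB' (Phi : 'M[C]_(dA * dB) -> 'M[C]_(dA' * dB')) :
  LOCC Phi -> forall rho, psd rho -> psd (Phi rho) /\ \tr (Phi rho) = \tr rho.
Proof.
elim=> {dA dB dA' dB' Phi} [dA dB Phi e|dA dB dA1 dA' dB' m K Phis Phi hK _ IH e
   |dA dB dB1 dA' dB' m K Phis Phi hK _ IH e] rho hrho; first by rewrite e.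
- have h j := IH j _ (psd_conj (kron (K j) (1%:M : 'M[C]_dB)) hrho).
  rewrite e; split; first by apply: psd_sum => j; exact: (h j).1.
  rewrite raddf_sum /= -(instrument_trace rho (kron_gramA dB hK)).
  by apply: eq_bigr => j _; exact: (h j).2.
- have h j := IH j _ (psd_conj (kron (1%:M : 'M[C]_dA) (K j)) hrho).
  rewrite e; split; first by apply: psd_sum => j; exact: (h j).1.
  rewrite raddf_sum /= -(instrument_trace rho (kron_gramB dA hK)).
  by apply: eq_bigr => j _; exact: (h j).2.
Qed.

(** Asymptotic continuity speaks of states only, so protocol outputs have to be recognised as
    such. *)
Lemma LOCC_state dA dB dA' dB' (Phi : 'M[C]_(dA * dB) -> 'M[C]_(dA' * dB')) rho :
  LOCC Phi -> is_state rho -> is_state (Phi rho).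
Proof. by move=> /LOCC_psd_trace h [/h [h1 h2] tr1]; split; rewrite ?h2. Qed.

Definition max_ent L : 'cV[C]_(L * L) := vec ((sqrtC L%:R)^-1)%:M.

Lemma adj_max_ent L : adj ((sqrtC L%:R)^-1%:M : 'M[C]_L) = (sqrtC L%:R)^-1%:M.
Proof. by rewrite adj_scalar_real // ger0_real // invr_ge0 sqrtC_ge0 ler0n. Qed.

Lemma fidelity_max_ent L (X : 'M[C]_L) :
  (adjmx (max_ent L) *m ketbra (vec X) *m max_ent L) 0 0 = `|\tr X| ^+ 2 / L%:R.
Proof.
have e : (adjmx (max_ent L) *m vec X) 0 0 = \tr X / sqrtC L%:R.
  rewrite inner_unvec !vecK adj_max_ent.
  by rewrite mul_mx_scalar mxtraceZ mulrC.
rewrite /ketbra !mulmxA -(mulmxA _ _ (max_ent L)) mxE big_ord1 e.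
have -> : (adjmx (vec X) *m max_ent L) 0 0 = ((adjmx (max_ent L) *m vec X) 0 0)^*%R.
  by rewrite -adjE adjmxE adjM adjK.
rewrite e -normCK normrM exprMn normfV; congr (_ * _).
by rewrite exprVn -normrX sqrtCK ger0_norm ?ler0n.
Qed.

Lemma unit_max_ent L : (0 < L)%N -> unit_vector (max_ent L).
Proof.
move=> L0; rewrite /unit_vector inner_unvec vecK adj_max_ent.
rewrite -scalar_mxM mxtrace_scalar -expr2 exprVn sqrtCK -[LHS]mulr_natl divff //.
by rewrite pnatr_eq0 -lt0n.
Qed.

Lemma vnS_max_ent L : (0 < L)%N -> vnS (ptrB L L (ketbra (max_ent L))) = ln L%:R.
Proof.
move=> L0; rewrite ptrB_ketbra vecK adj_max_ent.
rewrite -scalar_mxM -expr2 exprVn sqrtCK.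
have Lr : 0 < L%:R :> R by rewrite ltr0n.
rewrite (@vnS_eigdec _ _ _ (fun=> L%:R^-1)).
  rewrite sumr_const card_ord /eta lnV ?posrE // mulrN opprK -[LHS]mulr_natl mulrA.
  by rewrite divff ?mul1r // gt_eqF.
exists 1%:M; rewrite adjmxE adj1 mulmx1 mul1mx mulmx1; split=> //.
have -> : (L%:R^-1 : C) = (L%:R^-1 : R)%:C.
  by rewrite (fmorphV (real_complex R)) (rmorph_nat (real_complex R)).
by rewrite -diag_const_mx; congr diag_mx; apply/rowP => i; rewrite !mxE.
Qed.

Section TwoRound.
Variables (E : bip_fun R) (I J X : finType) (L : nat).
Hypothesis hE : entanglement_monotone E.
Variables (lam : I -> C).

Lemma protocol_AB dA dB (M : I -> 'M[C]_(dA, dB)) (K : J -> 'M[C]_(L, dA))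
    (D : J -> X -> 'M[C]_(L, dB)) :
  is_state (\sum_k lam k *: ketbra (vec (M k))) ->
  \sum_j adj (K j) *m K j = 1%:M -> (forall j, \sum_x adj (D j x) *m D j x = 1%:M) ->
  exists tau : 'M[C]_(L * L), [/\ is_state tau,
    E tau <= E (\sum_k lam k *: ketbra (vec (M k))) &
    (adjmx (max_ent L) *m tau *m max_ent L) 0 0 =
    \sum_j \sum_x \sum_k lam k * (`|\tr (K j *m M k *m (D j x)^T)| ^+ 2 / L%:R)].
Proof.
set sigma := \sum_k _ *: _ => hs hK hD.
pose Phi (rho : 'M[C]_(dA * dB)) := \sum_j (\sum_x actB (D j x) (actA (K j) rho)).
have hL : LOCC Phi.
  apply: (LOCC_A_fin (Phis := fun j rho => \sum_x actB (D j x) rho)) => // j.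
  by apply: (LOCC_B_fin (Phis := fun _ rho => rho)) => // x; exact: LOCC_id.
exists (Phi sigma); split; [exact: LOCC_state|exact: hE|].
rewrite /Phi mulmx_sumr mulmx_suml summxE; apply: eq_bigr => j _.
rewrite mulmx_sumr mulmx_suml summxE; apply: eq_bigr => x _.
rewrite actA_mixture actB_mixture mulmx_sumr mulmx_suml summxE; apply: eq_bigr => k _.
by rewrite -scalemxAr -scalemxAl mxE fidelity_max_ent !vecK.
Qed.

(** The mirror protocol is treated on its own because [E] is not assumed invariant under exchange of
    the parties. Transposing inside the trace brings the overlap to the form of [protocol_AB] with
    [(M k)^T]. *)
Lemma protocol_BA dA dB (M : I -> 'M[C]_(dA, dB)) (K : J -> 'M[C]_(L, dB))
    (D : J -> X -> 'M[C]_(L, dA)) :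
  is_state (\sum_k lam k *: ketbra (vec (M k))) ->
  \sum_j adj (K j) *m K j = 1%:M -> (forall j, \sum_x adj (D j x) *m D j x = 1%:M) ->
  exists tau : 'M[C]_(L * L), [/\ is_state tau,
    E tau <= E (\sum_k lam k *: ketbra (vec (M k))) &
    (adjmx (max_ent L) *m tau *m max_ent L) 0 0 =
    \sum_j \sum_x \sum_k lam k * (`|\tr (K j *m (M k)^T *m (D j x)^T)| ^+ 2 / L%:R)].
Proof.
set sigma := \sum_k _ *: _ => hs hK hD.
pose Phi (rho : 'M[C]_(dA * dB)) := \sum_j (\sum_x actA (D j x) (actB (K j) rho)).
have hL : LOCC Phi.
  apply: (LOCC_B_fin (Phis := fun j rho => \sum_x actA (D j x) rho)) => // j.
  by apply: (LOCC_A_fin (Phis := fun _ rho => rho)) => // x; exact: LOCC_id.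
exists (Phi sigma); split; [exact: LOCC_state|exact: hE|].
rewrite /Phi mulmx_sumr mulmx_suml summxE; apply: eq_bigr => j _.
rewrite mulmx_sumr mulmx_suml summxE; apply: eq_bigr => x _.
rewrite actB_mixture actA_mixture mulmx_sumr mulmx_suml summxE; apply: eq_bigr => k _.
rewrite -scalemxAr -scalemxAl mxE fidelity_max_ent !vecK.
by rewrite -[in LHS]mxtrace_tr !trmx_mul trmxK.
Qed.

End TwoRound.

End Protocols.

(** * Typicality for many copies *)

Section IID.
Variable R : realType.
Local Notation C := R[i].
Local Open Scope complex_scope.

(** The one-shot bound wants the decoder's marginal diagonal; right multiplication by [W] achieves
    this, with a conjugation because the second party's marginal appears transposed. *)
Lemma rotate_marginal (I : finType) m n (lam : I -> R) (M : I -> 'M[C]_(m, n)) :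
  (forall k, 0 <= lam k) -> \sum_k lam k = 1 -> orthonormal_mx M ->
  exists (W : 'M[C]_n) (beta : 'I_n -> R), [/\ W *m adj W = 1%:M,
    forall b, 0 <= beta b, \sum_b beta b = 1,
    vnS (reduced lam (fun k => (M k)^T)) = \sum_b eta (beta b) &
    \sum_k (lam k)%:C *: (adj (M k *m W) *m (M k *m W)) = rdiag beta].
Proof.
move=> l0 l1 orth; set rB := reduced _ _.
have sB : is_state rB.
  by apply: state_reduced => // k; rewrite trace_gram_tr orth eqxx.
have dB : eigdec rB (spec rB) by apply: spec_eigdec; case: sB => -[].
have [b0 b1] := state_eigdec sB dB; have [W [hW eW]] := dB.
exists (map_mx Num.conj W), (spec rB); split=> //; first exact: conj_unitary.
have -> : rdiag (spec rB) = (adj W *m rB *m W)^T.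
  rewrite [in RHS]eW adjmxE !mulmxA -(mulmxA _ (adj W) W) (unitary_comm hW) mulmx1 mul1mx.
  by rewrite tr_diag_mx.
rewrite mulmx_sumr mulmx_suml raddf_sum; apply: eq_bigr => k _ /=.
rewrite -scalemxAr -scalemxAl linearZ /=; congr (_ *: _).
rewrite adjM !trmx_mul !mulmxA; congr (_ *m _ *m _ *m _).
- by rewrite /adj; apply/matrixP => i j; rewrite !mxE conjCK.
- by rewrite /adj trmxK map_trmx.
- by rewrite trmxK.
- by rewrite /adj trmxK.
Qed.

Lemma iid_decoder r m n (lam : 'I_r -> R) (M : 'I_r -> 'M[C]_(m, n)) (delta : R) :
  (forall k, 0 <= lam k) -> \sum_k lam k = 1 -> orthonormal_mx M -> 0 < delta ->
  exists theta : R, [/\ 0 <= theta, theta < 1 & forall N L : nat, (0 < L)%N ->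
    exists (J X : finType) (K : J -> 'M[C]_(L, m ^ N)) (D : J -> X -> 'M[C]_(L, n ^ N)),
    [/\ \sum_j adj (K j) *m K j = 1%:M, forall j, \sum_x adj (D j x) *m D j x = 1%:M &
     (1 - 2 * (2 * theta ^+ N + L%:R * expR (- N%:R *
        (vnS (reduced lam (fun k => (M k)^T)) - \sum_k eta (lam k) - 2 * delta))))%:C
     <= \sum_j \sum_x \sum_(t : {ffun 'I_N -> 'I_r}) (\prod_k lam (t k))%:C *
        (`|\tr (K j *m tpow (fun k => M (t k)) *m (D j x)^T)| ^+ 2 / L%:R)]].
Proof.
move=> l0 l1 orth d0.
have [W [beta [hW b0 b1 eS marg]]] := rotate_marginal l0 l1 orth.
set sB := vnS _ in eS *; set sR := \sum_k eta (lam k).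
have [th1 [th10 th11 ch1]] := chernoff (fun k => - ln (lam k)) l0 l1 d0.
have [th2 [th20 th21 ch2]] := chernoff (fun b => ln (beta b)) b0 b1 d0.
have m1 : \sum_i lam i * - ln (lam i) = sR by apply: eq_bigr => i _; rewrite mulrN.
have m2 : \sum_i beta i * ln (beta i) = - sB.
  by rewrite eS -sumrN; apply: eq_bigr => i _; rewrite /eta opprK.
rewrite m1 in ch1; rewrite m2 in ch2.
exists (Num.max th1 th2); split; [by rewrite le_max th10|by rewrite gt_max th11 th21|].
move=> N L L0.
pose lamN (t : {ffun 'I_N -> 'I_r}) := \prod_k lam (t k).
pose betaN (b : 'I_(n ^ N)) := \prod_k beta (digits b k).
(* The thresholds sit [delta] beyond the two entropy rates, so [mu / lmin] decays at rate
   [sB - sR - 2 * delta]. *)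
pose lmin := expR (- N%:R * (sR + delta)); pose mu := expR (- N%:R * (sB - delta)).
pose MW (t : {ffun 'I_N -> 'I_r}) := tpow (fun k => M (t k) *m W).
pose T t := lmin <= lamN t; pose Tb b := betaN b <= mu.
have lN0 t : 0 <= lamN t by apply: prodr_ge0.
have bN0 b : 0 <= betaN b by apply: prodr_ge0.
have lN1 : \sum_t lamN t = 1.
  rewrite /lamN -(bigA_distr_bigA (fun _ => lam)) /= big1 // => k _; exact: l1.
have orthN : orthonormal_mx MW.
  move=> t u; rewrite /MW tpow_adj tpowM tpow_trace.
  transitivity (\prod_k (t k == u k)%:R : C).
    apply: eq_bigr => k _; rewrite adjM mulmxA -(mulmxA _ W) hW mulmx1; exact: orth.
  case: (eqVneq t u) => [->|ntu]; first by rewrite big1 // => k _; rewrite eqxx.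
  apply/eqP; rewrite prodf_seq_eq0; apply/hasP.
  have [/existsP [k hk]|/existsPn h] := boolP [exists k, t k != u k].
    by exists k; rewrite ?mem_index_enum //= (negbTE hk).
  by case/eqP: ntu; apply/ffunP => k; apply/eqP; have := h k; rewrite negbK.
have margN : \sum_t (lamN t)%:C *: (adj (MW t) *m MW t) = diag_mx (\row_b (betaN b)%:C).
  have -> : diag_mx (\row_b (betaN b)%:C) = tpow (fun _ : 'I_N => rdiag beta).
    by rewrite tpow_diag; congr diag_mx; apply/rowP => b; rewrite !mxE RtoC_prod.
  rewrite -marg tpow_sum; apply: eq_bigr => t _.
  by rewrite /MW tpow_adj tpowM RtoC_prod.
have lmin0 : 0 < lmin%:C by rewrite ltcR expR_gt0.
have lN0C t : 0 <= (lamN t)%:C by rewrite ler0c.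
have lN1C : \sum_t (lamN t)%:C = 1 by rewrite -RtoC_sum lN1.
have T_lam t : T t -> lmin%:C <= (lamN t)%:C by rewrite lecR.
have Tb_beta b : Tb b -> (betaN b)%:C <= mu%:C by rewrite lecR.
have mu0 : 0 <= mu%:C by rewrite ler0c expR_ge0.
have h := one_shot_fidelity lN0C lN1C orthN margN lmin0 T_lam Tb_beta mu0 L0.
pose WN := tpow (fun _ : 'I_N => W).
have hWN : WN *m adj WN = 1%:M.
  rewrite /WN tpow_adj tpowM -tpow1; apply/matrixP => a b; rewrite !mxE.
  by apply: eq_bigr => k _; rewrite hW.
have MWE t : MW t = tpow (fun k => M (t k)) *m WN by rewrite /WN tpowM.
(* The factor [WN^T] builds the change to the eigenbasis of the marginal into the decoder, so that
   the protocol acts on the original eigenvectors. *)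
exists _, _, (encoder C (m := m ^ N) (L := L)), (fun s x => decoder MW T Tb L0 s x *m WN^T).
split.
- exact: encoder_complete.
- move=> s.
  transitivity (adj WN^T *m
     (\sum_x adj (decoder MW T Tb L0 s x) *m decoder MW T Tb L0 s x) *m WN^T).
    by rewrite mulmx_sumr mulmx_suml; apply: eq_bigr => x _; rewrite adjM !mulmxA.
  rewrite decoder_complete mulmx1.
  have -> : adj WN^T = map_mx Num.conj WN by rewrite /adj map_trmx trmxK.
  have -> : WN^T = adj (map_mx Num.conj WN).
    by apply/matrixP => a b; rewrite adjE [map_mx _ _ _ _]mxE conjCK mxE.
  exact: conj_unitary.
have -> : \sum_(j : {ffun 'I_L * 'I_(m ^ N) -> bool}) \sum_x
      \sum_(t : {ffun 'I_N -> 'I_r}) (\prod_k lam (t k))%:C *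
        (`|\tr (encoder C j *m tpow (fun k => M (t k)) *m
                (decoder MW T Tb L0 j x *m WN^T)^T)| ^+ 2 / L%:R) =
   \sum_(j : {ffun 'I_L * 'I_(m ^ N) -> bool}) \sum_x \sum_t (lamN t)%:C *
        (`|\tr (encoder C j *m MW t *m (decoder MW T Tb L0 j x)^T)| ^+ 2 / L%:R).
  apply: eq_bigr => j _; apply: eq_bigr => x _; apply: eq_bigr => t _.
  by rewrite trmx_mul trmxK MWE !mulmxA.
apply: le_trans h.
have pT : \sum_(t | ~~ T t) lamN t <= th1 ^+ N.
  apply: le_trans (ch1 N); rewrite big_mkcond [leRHS]big_mkcond; apply: ler_sum => t _.
  case: ifP => // nT; case: ifP => // /negP hf; last exact: lN0.
  (* A word of weight zero contributes nothing, so it may lie outside the Chernoff event; for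
     positive weight every letter is positive and the logarithm of the product splits. *)
  rewrite leNgt; apply/negP => lt0; apply: hf.
  have hk k : 0 < lam (t k).
    rewrite lt_def l0 andbT; apply/eqP => e; move: lt0.
    by rewrite /lamN (bigD1 k) //= e mul0r ltxx.
  rewrite sumrN lerNr -(ln_prod hk).2 -mulNr.
  move: nT; rewrite /T /lmin -ltNge -[lamN t]lnK ?posrE // ltr_expR => /ltW //.
have pB : \sum_(b | ~~ Tb b) betaN b <= th2 ^+ N.
  apply: le_trans (ch2 N); rewrite big_mkcond [leRHS]big_mkcond.
  rewrite -[leRHS](sum_digits (fun t : {ffun 'I_N -> 'I_n} =>
     if N%:R * (- sB + delta) <= \sum_k ln (beta (t k)) then \prod_k beta (t k) else 0)).
  apply: ler_sum => b _.
  case: ifP => nT; last by case: ifP => // _; exact: bN0.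
  case: ifP => // /negP hf.
  rewrite leNgt; apply/negP => lt0; apply: hf.
  have hk k : 0 < beta (digits b k).
    rewrite lt_def b0 andbT; apply/eqP => e; move: lt0.
    by rewrite /betaN (bigD1 k) //= e mul0r ltxx.
  rewrite -(ln_prod hk).2 -[_ * _]opprK -mulNr -mulrN opprD opprK.
  move: nT; rewrite /Tb /mu -ltNge -[betaN b]lnK ?posrE // ltr_expR => /ltW.
  by rewrite mulNr -mulrN opprB addrC.
have LE : (L%:R : C) = (L%:R : R)%:C by rewrite (rmorph_nat (real_complex R)).
have muE : mu / lmin = expR (- N%:R * (sB - sR - 2 * delta)).
  by rewrite /mu /lmin -expRN -expRD; congr expR; ring.
rewrite -!RtoC_sum LE -(fmorphV (real_complex R)) -!RtoCM -!RtoCD muE.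
have -> : forall x : R, 1 - 2 * x%:C = (1 - 2 * x)%:C.
  move=> x; have -> : (2 : C) = (2 : R)%:C by rewrite (rmorph_nat (real_complex R)).
  by rewrite -RtoCM; exact: esym (rmorphB (real_complex R) 1 (2 * x)).
rewrite lecR lerD2l lerN2 ler_pM2l // lerD2r.
have mx1' : th1 ^+ N <= Num.max th1 th2 ^+ N.
  by rewrite lerXn2r ?nnegrE ?le_max ?th10 ?lexx.
have mx2' : th2 ^+ N <= Num.max th1 th2 ^+ N.
  by rewrite lerXn2r ?nnegrE ?le_max ?th10 ?th20 ?lexx ?orbT.
by lra.
Qed.

End IID.

(** * From distillation protocols to the regularised measure *)

Section Hashing.
Variable R : realType.
Local Notation C := R[i].
Local Open Scope complex_scope.

(** Two copies of [d] are lost to typicality in [iid_decoder]; the third separates the distillation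
    rate from the decoupling threshold. *)
Lemma le_of_forall_sub_le (a b : R) : (forall d, 0 < d -> a - 3 * d <= b) -> a <= b.
Proof.
move=> h; rewrite leNgt; apply/negP => ba.
by have := h ((a - b) / 6); rewrite divr_gt0 ?subr_gt0 // => /(_ isT); lra.
Qed.

Lemma cvg_invn : (fun N : nat => N%:R^-1 : R) @ \oo --> (0 : R).
Proof. by rewrite -cvg_shiftS; exact: cvg_harmonic. Qed.

Lemma cvg_expR_decay (delta : R) : 0 < delta ->
  (fun N : nat => expR (- N%:R * delta)) @ \oo --> (0 : R).
Proof.
move=> d0; under eq_fun do rewrite mulNr -mulrN expRM_natl.
by apply: cvg_expr; rewrite ger0_norm ?expR_ge0 // -expR0 ltr_expR oppr_lt0.
Qed.

(** At rank about [expR (N * c)] the fidelity tends to one, so [E tau] differs from [ln L] by a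
    vanishing multiple of [1 + 2 * ln L], which is linear in [N]. Dividing by [N] leaves the rate
    [c]. *)
Lemma distillation_bound (E : bip_fun R) (x : nat -> R) (l c theta delta : R) :
  proper_measure E -> 0 < c -> 0 <= theta -> theta < 1 -> 0 < delta ->
  (forall N L : nat, (0 < L)%N -> exists (tau : 'M[C]_(L * L)) (F : R),
     [/\ is_state tau, E L L tau <= x N,
      (adjmx (max_ent R L) *m tau *m max_ent R L) 0 0 = F%:C &
      1 - 2 * (2 * theta ^+ N + L%:R * expR (- N%:R * (c + delta))) <= F]) ->
  (fun N : nat => N%:R^-1 * x N) @ \oo --> l -> c <= l.
Proof.
move=> [_ hpure hcont] c0 t0 t1 d0 hyp hl.
pose L (N : nat) := Num.truncn (expR (N%:R * c)).
have Lub N : (L N)%:R <= expR (N%:R * c).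
  by have /andP [] := truncn_itv (expR_ge0 (N%:R * c)).
have L0 N : (0 < L N)%N.
  rewrite /L truncn_gt0 -[leLHS]expR0 ler_expR mulr_ge0 ?ler0n // ltW //.
(* Rounding down at most halves a number that is at least one; in the rate this costs [ln 2 / N]. *)
have Llb N : expR (N%:R * c) <= 2 * (L N)%:R.
  have /andP [_ h] := truncn_itv (expR_ge0 (N%:R * c)).
  apply: le_trans (ltW h) _; rewrite -/(L N) -natr1.
  by have h1 : 1 <= (L N)%:R :> R; [rewrite ler1n L0|lra].
have Lp N : 0 < (L N)%:R :> R by rewrite ltr0n.
pose T N := cid (hyp N (L N) (L0 N)).
pose tau N := projT1 (T N).
have htau N : exists F : R,
     [/\ is_state (tau N), E (L N) (L N) (tau N) <= x N,
      (adjmx (max_ent R (L N)) *m tau N *m max_ent R (L N)) 0 0 = F%:C &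
      1 - 2 * (2 * theta ^+ N + (L N)%:R * expR (- N%:R * (c + delta))) <= F].
  exact: (projT2 (T N)).
have stau N : is_state (tau N) by have [F []] := htau N.
have etau N : E (L N) (L N) (tau N) <= x N by have [F []] := htau N.
pose phi N := ketbra (max_ent R (L N)).
have sphi N : is_state (phi N) by apply: state_ketbra; exact: unit_max_ent.
pose err (N : nat) : R := 2 * Num.sqrt (2 * (2 * (2 * theta ^+ N + expR (- N%:R * delta)))).
have trle N : trnorm (tau N - phi N) <= err N.
  have [F [_ _ hF Fge]] := htau N.
  apply: (le_trans (trnorm_pure_le (stau N) (unit_max_ent R (L0 N)) hF)).
  rewrite /err ler_pM2l // ler_wsqrtr // ler_pM2l //.
  have : (L N)%:R * expR (- N%:R * (c + delta)) <= expR (- N%:R * delta).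
    apply: (@le_trans _ _ (expR (N%:R * c) * expR (- N%:R * (c + delta)))).
      by rewrite ler_wpM2r ?expR_ge0.
    by rewrite -expRD ler_expR; lra.
  by lra.
have err0 : err @ \oo --> (0 : R).
  have e : (fun N : nat => 2 * theta ^+ N + expR (- N%:R * delta)) @ \oo --> (0 : R).
    rewrite -[0 : R](addr0 0) -[X in X + _](mulr0 2).
    apply: cvgD; last exact: cvg_expR_decay.
    apply: cvgM; first exact: cvg_cst.
    by apply: cvg_expr; rewrite ger0_norm.
  rewrite -[0 : R](mulr0 2); apply: cvgM; first exact: cvg_cst.
  rewrite -(sqrtr0 R); apply: (continuous_cvg _ (@sqrt_continuous R _)).
  rewrite -[0 : R](mulr0 2); apply: cvgM; first exact: cvg_cst.
  by rewrite -[0 : R](mulr0 2); apply: cvgM; first exact: cvg_cst.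
have tr0 : (fun N => trnorm (tau N - phi N)) @ \oo --> (0 : R).
  apply: (squeeze_cvgr _ (cvg_cst 0) err0); apply: nearW => N.
  by rewrite trle andbT /trnorm sumr_ge0.
have := hcont L L tau phi stau sphi tr0; set q := fun k => _ => q0.
pose w (N : nat) := c - ln 2 * N%:R^-1 - `|q N| * (1 + 2 * c).
have wc : w @ \oo --> c.
  have -> : c = c - ln 2 * 0 - `|0 : R| * (1 + 2 * c) by rewrite normr0; ring.
  apply: cvgB; first apply: cvgB; first exact: cvg_cst.
    by apply: cvgM; [exact: cvg_cst|exact: cvg_invn].
  by apply: cvgM; [apply: cvg_norm|exact: cvg_cst].
apply: (ler_cvg_to wc hl).
near=> N; have N0 : (0 < N)%N by near: N; exact: nbhs_infty_gt.
have NR : 0 < N%:R :> R by rewrite ltr0n.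
have N1 : 1 <= N%:R :> R by rewrite ler1n.
have lnub : ln (L N)%:R <= N%:R * c.
  by rewrite -[leRHS]expRK ler_ln ?posrE ?expR_gt0.
have lnlb : N%:R * c - ln 2 <= ln (L N)%:R.
  by rewrite lerBlDl -lnM ?posrE // -[leLHS]expRK ler_ln ?posrE ?expR_gt0 ?mulr_gt0.
have ln0 : 0 <= ln (L N)%:R :> R by rewrite ln_ge0 // ler1n.
have den : 1 + ln (L N * L N)%:R = 1 + 2 * ln (L N)%:R :> R.
  by rewrite natrM lnM ?posrE //; ring.
have dn : 1 + 2 * ln (L N)%:R != 0 :> R.
  by rewrite gt_eqF // ltr_pwDl // mulr_ge0.
have Ephi : E (L N) (L N) (phi N) = ln (L N)%:R.
  exact: etrans (hpure _ _ _ (unit_max_ent R (L0 N))) (vnS_max_ent R (L0 N)).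
have Eq : E (L N) (L N) (tau N) = ln (L N)%:R + q N * (1 + 2 * ln (L N)%:R).
  have -> : q N * (1 + 2 * ln (L N)%:R) = E (L N) (L N) (tau N) - E (L N) (L N) (phi N).
    by rewrite /q den (divfK dn).
  by rewrite Ephi addrC subrK.
(* The sign of [q N] is unknown, so the denominator is bounded from above, using [1 <= N] to absorb
   the additive one. *)
have qb : - (`|q N| * (N%:R * (1 + 2 * c))) <= q N * (1 + 2 * ln (L N)%:R).
  have h1 := lerNnormlW (lexx `|q N|).
  have h2 : (1 + 2 * ln (L N)%:R) <= N%:R * (1 + 2 * c) by nra.
  have h3 : 0 <= 1 + 2 * ln (L N)%:R :> R by lra.
  have h4 := normr_ge0 (q N).
  by nra.
have xN := etau N; rewrite Eq in xN; clear Eq Ephi den dn.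
rewrite -(ler_pM2l NR) mulrA divff ?gt_eqF // mul1r; apply: le_trans xN.
have -> : N%:R * w N = (N%:R * c - ln 2) - `|q N| * (N%:R * (1 + 2 * c)).
  by rewrite /w; field; rewrite gt_eqF.
by lra.
Unshelve. all: by end_near.
Qed.

(** The order on [R[i]] relates only numbers with equal imaginary part, so a lower bound by a real
    makes the fidelity real. *)
Lemma complex_real_bound (x : R) (z : C) : x%:C <= z -> exists2 F : R, z = F%:C & x <= F.
Proof.
by case: z => a b; rewrite lecE /= => /andP [/eqP -> xa]; exists a.
Qed.

Section Mixture.
Variables (E : bip_fun R) (dA dB r : nat) (lam : 'I_r -> R) (M : 'I_r -> 'M[C]_(dA, dB)).
Hypotheses (hE : proper_measure E) (lam_ge0 : forall k, 0 <= lam k).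
Hypotheses (lam_sum : \sum_k lam k = 1) (orth : orthonormal_mx M).
Let rho := \sum_k (lam k)%:C *: ketbra (vec (M k)).
Variable Einf : R.
Hypothesis hEinf : reg_seq E rho @ \oo --> Einf.

Let rhoN N := \sum_(t : {ffun 'I_N -> 'I_r})
  (\prod_k lam (t k))%:C *: ketbra (vec (tpow (fun k => M (t k)))).

Lemma prodstate_rhoN N : prodstate (fun _ : 'I_N => rho) = rhoN N.
Proof.
rewrite prodstate_mixture; apply: eq_bigr => t _; rewrite RtoC_prod; congr (_ *: ketbra (vec _)).
by apply/matrixP => a b; rewrite !mxE; apply: eq_bigr => k _; rewrite vecK.
Qed.

Lemma state_rhoN N : is_state (rhoN N).
Proof.
apply: state_mixture => [t||t]; first by apply: prodr_ge0.
  by rewrite -(bigA_distr_bigA (fun _ => lam)) /= big1.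
apply: state_ketbra; rewrite /unit_vector inner_unvec vecK tpow_adj tpowM tpow_trace.
by rewrite big1 // => k _; rewrite orth eqxx.
Qed.

(** Both parties can measure everything and keep a one-dimensional system. Its only state is
    [max_ent] of rank one, on which [E] is [ln 1 = 0], so monotonicity makes [E] nonnegative. *)
Lemma hashing_ge0 : 0 <= Einf.
Proof.
have [hmon hpure _] := hE.
apply: (ler_cvg_to (cvg_cst 0) hEinf); apply: nearW => N.
rewrite mulr_ge0 ?invr_ge0 ?ler0n // prodstate_rhoN.
have comp n : \sum_(j < n) adj (delta_mx 0 j : 'M[C]_(1, n)) *m delta_mx 0 j = 1%:M.
  rewrite [RHS]mx1_sum_delta; apply: eq_bigr => j _.
  by rewrite /adj map_delta_mx trmx_delta mul_delta_mx.
have [tau [stau Etau _]] :=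
  protocol_AB hmon (state_rhoN N) (comp (dA ^ N)%N) (fun _ => comp (dB ^ N)%N).
apply: le_trans Etau.
have -> : tau = ketbra (max_ent R 1).
  have [_ h] := state_ketbra (unit_max_ent R (ltnSn 0)); have [_ h'] := stau.
  apply/matrixP => i j; rewrite !ord1; move: h h'; rewrite /mxtrace !big_ord1 => h h'.
  by rewrite h'.
by rewrite (etrans (hpure _ _ _ (unit_max_ent R (ltnSn 0))) (vnS_max_ent R (ltnSn 0))) ln1.
Qed.

Lemma hashing_AB :
  vnS (reduced lam (fun k => (M k)^T)) - \sum_k eta (lam k) <= Einf.
Proof.
apply: le_of_forall_sub_le => d d0; set s := vnS _ - _.
(* [distillation_bound] needs a positive rate; otherwise nonnegativity of [Einf] suffices. *)
have [c0|c0] := leP (s - 3 * d) 0; first exact: le_trans c0 hashing_ge0.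
have [th [th0 th1 hdec]] := iid_decoder lam_ge0 lam_sum orth d0.
apply: (distillation_bound hE c0 th0 th1 d0 _ hEinf) => N L L0.
have [J [X [K [D [hK hD hF]]]]] := hdec N L L0.
have [hmon _ _] := hE.
have [tau [stau Etau Ftau]] := protocol_AB hmon (state_rhoN N) hK hD.
have [F eF Fge] := complex_real_bound hF.
exists tau, F; split=> //; first by rewrite prodstate_rhoN.
  by rewrite Ftau eF.
apply: le_trans Fge; rewrite -/s le_eqVlt; apply/orP; left; apply/eqP.
by congr (1 - 2 * (_ + _ * expR (_ * _))); ring.
Qed.

Lemma hashing_BA : vnS (reduced lam M) - \sum_k eta (lam k) <= Einf.
Proof.
apply: le_of_forall_sub_le => d d0; set s := vnS _ - _.
have [c0|c0] := leP (s - 3 * d) 0; first exact: le_trans c0 hashing_ge0.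
have orthT : orthonormal_mx (fun k => (M k)^T).
  by move=> k l; rewrite -(orth k l) gram_tr mxtrace_tr mxtrace_mulC.
have [th [th0 th1 hdec]] := iid_decoder lam_ge0 lam_sum orthT d0.
apply: (distillation_bound hE c0 th0 th1 d0 _ hEinf) => N L L0.
have [J [X [K [D [hK hD hF]]]]] := hdec N L L0.
have [hmon _ _] := hE.
have [tau [stau Etau Ftau]] := protocol_BA hmon (state_rhoN N) hK hD.
have [F eF Fge] := complex_real_bound hF.
exists tau, F; split=> //; first by rewrite prodstate_rhoN.
  rewrite Ftau -eF; apply: eq_bigr => j _; apply: eq_bigr => y _; apply: eq_bigr => t _.
  by rewrite tpow_tr.
apply: le_trans Fge; rewrite le_eqVlt; apply/orP; left; apply/eqP.
have -> : reduced lam (fun k => ((M k)^T)^T) = reduced lam M.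
  by apply: eq_bigr => k _; rewrite trmxK.
by rewrite -/s; congr (1 - 2 * (_ + _ * expR (_ * _))); ring.
Qed.

End Mixture.
End Hashing.

(** * The pure-state source and the final comparison *)

Section Source.
Variable R : realType.
Local Notation C := R[i].

Lemma spectral_mixture n (rho : 'M[C]_n) (d : 'I_n -> R) (U : 'M[C]_n) :
  rho = U *m rdiag d *m adj U -> rho = \sum_k ((d k)%:C)%C *: ketbra (col k U).
Proof.
move=> ->; apply/matrixP => i j; rewrite summxE mxE; apply: eq_bigr => k _.
by rewrite [RHS]mxE ketbraE mul_mx_diag adjE !mxE; ring.
Qed.

(** Entanglement entropy is additive over tensor factors, so each of the [N] positions contributes
    the same average and the sequence is constant. [N = 0] is excluded because there the
    normalisation [N%:R^-1] is zero. *)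
Lemma ens_seq_pure (E : bip_fun R) dA dB n (p : 'I_n -> R)
    (psi : 'I_n -> 'cV[C]_(dA * dB)) N :
  normalized_on_pure E -> \sum_i p i = 1 -> (forall i, unit_vector (psi i)) ->
  (0 < N)%N ->
  ens_seq E p (fun i => ketbra (psi i)) N = \sum_i p i * vnS (ptrB dA dB (ketbra (psi i))).
Proof.
move=> hpure p1 hpsi N0; rewrite /ens_seq.
set h := fun i => vnS (ptrB dA dB (ketbra (psi i))).
have e (t : {ffun 'I_N -> 'I_n}) :
    E _ _ (prodstate (fun k => ketbra (psi (t k)))) = \sum_k h (t k).
  rewrite prodstate_ketbra hpure; last first.
    rewrite /unit_vector inner_unvec vecK tpow_adj tpowM tpow_trace big1 // => k _.
    by rewrite -inner_unvec hpsi.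
  rewrite ptrB_ketbra vecK tpow_adj tpowM vnS_tpow.
    by apply: eq_bigr => k _; rewrite /h ptrB_ketbra.
  by move=> k; split; [exact: psd_gram|rewrite -inner_unvec hpsi].
under eq_bigr do rewrite e.
rewrite (sum_prod_expectation (fun _ => h) (fun _ => p1)) sumr_const card_ord.
by rewrite -[X in _ * X]mulr_natl mulrA mulVf ?mul1r // pnatr_eq0 -lt0n.
Qed.

End Source.

Theorem theorem1 (R : realType) (dA dB n : nat) (p : 'I_n -> R)
  (psi : 'I_n -> 'cV[R[i]]_(dA * dB))
  (hp : forall i, 0 < p i) (hsum : \sum_(i < n) p i = 1)
  (hpsi : forall i, unit_vector (psi i))
  (rho : 'M[R[i]]_(dA * dB))
  (hrho : rho = \sum_(i < n) ((p i)%:C)%C *: ketbra (psi i))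
  (hS : 0 < vnS rho)
  (E : bip_fun R) (hE : proper_measure E)
  (ES Einf : R)
  (hES : ens_seq E p (fun i => ketbra (psi i)) @ \oo --> ES)
  (hEinf : reg_seq E rho @ \oo --> Einf) :
  (ES - Einf) / shannon p
    <= 1 - `|vnS (ptrB dA dB rho) - vnS (ptrA dA dB rho)| / vnS rho.
Proof.
have p0 i : 0 <= p i by exact: ltW.
have srho : is_state rho.
  by rewrite hrho; apply: state_mixture => // i; exact: state_ketbra.
have drho : eigdec rho (spec rho) by apply: spec_eigdec; case: srho => -[].
have [l0 l1] := state_eigdec srho drho; have [U [hU eU]] := drho.
(* The hashing bound and Araki-Lieb are applied to the eigen-ensemble of [rho], whose matrices are
   orthonormal; the given [psi i] need not be orthogonal and enter only through [ES] and
   [shannon p]. *)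
pose lam := spec rho; pose M k := unvec (col k U).
have orth : orthonormal_mx M.
  move=> k l; rewrite -inner_unvec; have /matrixP/(_ l k) := unitary_comm hU.
  rewrite !mxE eq_sym => <-; apply: eq_bigr => i _.
  by rewrite adjmxE !adjE !mxE.
have rhoE : rho = \sum_k ((lam k)%:C)%C *: ketbra (vec (M k)).
  rewrite {1}(spectral_mixture eU); apply: eq_bigr => k _.
  by rewrite /M unvecK.
have eA : ptrB dA dB rho = reduced lam M.
  by rewrite {1}rhoE ptrB_lin; apply: eq_bigr => k _; rewrite ptrB_ketbra vecK.
have eB : ptrA dA dB rho = reduced lam (fun k => (M k)^T).
  by rewrite {1}rhoE ptrA_lin; apply: eq_bigr => k _; rewrite ptrA_ketbra vecK.
have hEinf' : reg_seq E (\sum_k ((lam k)%:C)%C *: ketbra (vec (M k))) @ \oo --> Einf.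
  by rewrite -rhoE.
have h1 := hashing_AB hE l0 l1 orth hEinf'; have h2 := hashing_BA hE l0 l1 orth hEinf'.
have tr1 k : \tr (M k *m adj (M k)) = 1 by rewrite orth eqxx.
have al1 := araki_lieb l0 l1 tr1.
have al2 : vnS (reduced lam M) <= vnS (reduced lam (fun k => (M k)^T)) + \sum_k eta (lam k).
  have -> : reduced lam M = reduced lam (fun k => ((M k)^T)^T).
    by apply: eq_bigr => k _; rewrite trmxK.
  by apply: araki_lieb => // k; rewrite trace_gram_tr.
rewrite -[\sum_k eta _]/(vnS rho) -eB in h1; rewrite -[\sum_k eta _]/(vnS rho) -eA in h2.
rewrite -[\sum_k eta _]/(vnS rho) -eA -eB in al1 al2.
have [_ hpure _] := hE.
pose s := \sum_i p i * vnS (ptrB dA dB (ketbra (psi i))).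
have ESE : ES = s.
  apply: (cvg_unique (@norm_hausdorff _ R) hES); apply: cvg_near_cst.
  near=> N; rewrite ens_seq_pure //.
  by near: N; exact: nbhs_infty_gt.
have sA : s <= vnS (ptrB dA dB rho).
  rewrite hrho ptrB_lin; apply: vnS_concave => // i; rewrite ptrB_ketbra.
  by split; [exact: psd_gram|rewrite -inner_unvec hpsi].
have sB : s <= vnS (ptrA dA dB rho).
  (* Each pure state has equal entropies on both sides, so concavity can also be used for the second
     party's marginal. *)
  have -> : s = \sum_i p i * vnS (ptrA dA dB (ketbra (psi i))).
    by apply: eq_bigr => i _; rewrite ptrB_ketbra ptrA_ketbra vnS_gram_tr.
  rewrite hrho ptrA_lin; apply: vnS_concave => // i; rewrite ptrA_ketbra.
  by split; [exact: psd_gram|rewrite trace_gram_tr -inner_unvec hpsi].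
have HS : vnS rho <= shannon p by rewrite hrho; exact: vnS_le_shannon.
have H0 : 0 < shannon p by exact: lt_le_trans HS.
set a := vnS (ptrB _ _ _) in h1 h2 al1 al2 sA *.
set b := vnS (ptrA _ _ _) in h1 h2 al1 al2 sB *.
have key : ES - Einf <= vnS rho - `|a - b|.
  by rewrite ESE; case: (ger0P (a - b)) => _; lra.
have pos : 0 <= vnS rho - `|a - b|.
  by case: (ger0P (a - b)) => _; lra.
have -> : 1 - `|a - b| / vnS rho = (vnS rho - `|a - b|) / vnS rho.
  by rewrite mulrBl divff ?gt_eqF.
apply: (@le_trans _ _ ((vnS rho - `|a - b|) / shannon p)).
  by rewrite ler_pM2r ?invr_gt0.
by rewrite ler_wpM2l // lef_pV2 ?posrE.
Unshelve. all: by end_near.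
Qed.
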